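(* Let $\lambda<1$ and $0<\beta<1-\lambda$. Then $$\lim_{N\to\infty}\frac1N\mathbb E\log Z_N(\beta,\lambda;J)=-\frac12\log(1-\lambda),$$ i.e. the quenched pressure at zero external field coincides with the annealed one.
   Context: For $N\ge 1$, $\beta>0$, $\lambda\in\mathbb{R}$, let $J=(J_{ij})_{i,j=1}^N$ be $N^2$ i.i.d. standard Gaussian $\mathcal N(0,1)$ random variables (one for each ordered pair $(i,j)$, diagonal pairs included). $\mathbb E_z$ denotes integration with respect to the standard Gaussian measure $(2\pi)^{-N/2}e^{-\|z\|^2/2}dz$ on $\mathbb R^N$, and $\mathbb E$ denotes expectation with respect to the disorder. The (zero-field) partition function is $$Z_N(\beta,\lambda;J)=\mathbb E_z\exp\Big(\frac{\beta}{\sqrt{2N}}\sum_{i,j=1}^N J_{ij}z_iz_j-\frac{\beta^2}{4N}\Big(\sum_{i=1}^N z_i^2\Big)^2+\frac{\lambda}{2}\sum_{i=1}^N z_i^2\Big).$$ *)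

(* Defs.v *)
From HB Require Import structures.
From mathcomp Require Import all_boot all_order all_algebra.
From mathcomp Require Import all_classical all_reals all_analysis.
Set Implicit Arguments. Unset Strict Implicit. Unset Printing Implicit Defensive.
Import Order.TTheory GRing.Theory Num.Theory.
Import numFieldNormedType.Exports.
Local Open Scope classical_set_scope.
Local Open Scope ring_scope.

Section SK.
Variable R : realType.

Definition gauss_dens (x : R) : R := expR (- (x ^+ 2) / 2) / Num.sqrt (pi *+ 2).

Definition scons (x : R) (z : nat -> R) : nat -> R :=
  fun k => if k is k'.+1 then z k' else x.

(* [gauss_int n f] = E_z f(z_0,...,z_{n-1}) for z standard Gaussian in R^n,
   computed as an iterated (Tonelli) integral; intended for NONNEGATIVE f
   (coordinates z_k with k >= n are set to 0 and irrelevant). *)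
Fixpoint gauss_int (n : nat) (f : (nat -> R) -> \bar R) : \bar R :=
  match n with
  | 0 => f (fun _ => 0)
  | n'.+1 => (\int[@lebesgue_measure R]_(x in setT)
                 ((gauss_dens x)%:E * gauss_int n' (fun z => f (scons x z))))%E
  end.

Definition SK_exponent (beta lambda : R) (N : nat) (J : nat -> nat -> R)
    (z : nat -> R) : R :=
  beta / Num.sqrt (N%:R *+ 2) * (\sum_(i < N) \sum_(j < N) J i j * z i * z j)
  - beta ^+ 2 / (N%:R *+ 4) * (\sum_(i < N) z i ^+ 2) ^+ 2
  + lambda / 2 * (\sum_(i < N) z i ^+ 2).

Definition Z_N (beta lambda : R) (N : nat) (J : nat -> nat -> R) : \bar R :=
  gauss_int N (fun z => (expR (SK_exponent beta lambda N J z))%:E).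

(* the N^2 i.i.d. disorder variables g_0..g_{N^2-1} arranged as J_{ij} = g_{iN+j} *)
Definition J_of (N : nat) (g : nat -> R) : nat -> nat -> R :=
  fun i j => g (i * N + j)%N.

Definition logZ (beta lambda : R) (N : nat) (g : nat -> R) : R :=
  ln (fine (Z_N beta lambda N (J_of N g))).

Definition ElogZ (beta lambda : R) (N : nat) : \bar R :=
  (gauss_int (N * N) (fun g => (Num.max (logZ beta lambda N g) 0)%:E)
   - gauss_int (N * N) (fun g => (Num.max (- logZ beta lambda N g) 0)%:E))%E.

End SK.

(* Main.v *)
Require Import Defs.
From HB Require Import structures.
From mathcomp Require Import all_boot all_order all_algebra.
From mathcomp Require Import all_classical all_reals all_analysis.
From mathcomp Require Import measurable_realfun ring lra.
Import Order.TTheory GRing.Theory Num.Theory.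
Import numFieldNormedType.Exports.
Local Open Scope classical_set_scope.
Local Open Scope ring_scope.
Set Implicit Arguments. Unset Strict Implicit. Unset Printing Implicit Defensive.

(** Since [E Z = A^N] with [A = (1 - lambda)^(-1/2)], Jensen's inequality gives
    the upper bound.  For the lower bound, [E Z^2] is infinite, so [Z] is
    replaced by its restriction [Y] to the [z] with [|z|^2 <= N / beta] and
    [z_i^2 <= T] for all [i].  Then [E Y] is at least a fixed fraction of
    [A^N], [E Y^2 = O((E Y)^2)], and [log Y] is Lipschitz in each single
    disorder variable with the small constant [beta T / sqrt (2 N)].  If [G > 0]
    is a function of [n] independent Gaussians and [log G] is [c]-Lipschitz in
    each of them, then [E G * E (1/G) <= exp (n c^2)].  Taking [G = (Y / E Y)^s],
    whose mean is bounded below uniformly in [s <= 1] by the second moment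
    estimate, one gets [E (Y / E Y)^(-s) <= K exp (N^2 s^2 c^2)] and, by Jensen
    again, [E log Y >= log E Y - (log K + N^2 s^2 c^2) / s].  The choice
    [T = N^(1/4)], [s = N^(-3/4)] makes the error [O(N^(3/4))]. *)

(** * Gaussian measures on the space of real sequences *)

(** All dimensions live on the one space of infinite sequences, with the product sigma-algebra
    generated by the coordinates. This matches the integrands of [gauss_int], and both [N] and
    [N * N] variables fit in it. *)
Definition cylinder_sets (R : realType) : set (set (nat -> R)) :=
  \bigcup_k preimage_set_system [set: nat -> R] (fun z => z k) measurable.
Notation rseq R := (g_sigma_algebraType (@cylinder_sets R)).

Section sequence_space.
Variable R : realType.

Lemma measurable_coord k : measurable_fun [set: rseq R] (fun z : rseq R => z k).
Proof.
move=> _ A mA; apply: sub_sigma_algebra.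
by exists k => //; exists A.
Qed.

Lemma measurable_fun_rseq d (T : measurableType d) (h : T -> rseq R) :
  (forall k, measurable_fun setT (fun t => h t k)) -> measurable_fun setT h.
Proof.
move=> mh; apply: (@measurability _ _ T (rseq R) setT h (@cylinder_sets R)) => //.
move=> _ [_ [k _ [A mA <-]] <-].
by rewrite setTI; exact: mh.
Qed.

Definition scons_pair (p : measurableTypeR R * rseq R) : rseq R := scons p.1 p.2.

Lemma measurable_scons : measurable_fun setT scons_pair.
Proof.
apply: measurable_fun_rseq => -[|k] /=; first exact: measurable_fst.
exact: (measurableT_comp (measurable_coord k) measurable_snd).
Qed.

HB.instance Definition _ := @isMeasurableFun.Build _ _ _ _ _ measurable_scons.

Definition gauss1 : probability (measurableTypeR R) R := normal_prob 0 1.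

Lemma gauss_densE : @gauss_dens R = normal_pdf 0 1.
Proof.
rewrite normal_pdfE ?oner_eq0//; apply/funext => x.
by rewrite /gauss_dens /normal_peak /normal_fun expr1n mul1r subr0 mulrC.
Qed.

(** Change of variables through the Radon-Nikodym derivative of [gauss1]. It equals [gauss_dens]
    almost everywhere, since both integrate to the [gauss1] mass over every measurable set. *)
Lemma integral_gauss1 (f : R -> \bar R) : measurable_fun setT f ->
  (forall x, 0 <= f x)%E ->
  (\int[gauss1]_x f x =
   \int[@lebesgue_measure R]_x ((gauss_dens x)%:E * f x))%E.
Proof.
move=> mf f0.
have dom : gauss1 `<< @lebesgue_measure R by exact: normal_prob_dominates.
rewrite -(Radon_Nikodym_SigmaFinite.change_of_variables dom)//.
have mg : measurable_fun setT (fun x : R => (gauss_dens x)%:E).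
  by rewrite gauss_densE; apply/measurable_EFinP; exact: measurable_normal_pdf.
have intf := Radon_Nikodym_SigmaFinite.f_integrable dom.
apply: ae_eq_integral => //.
- by apply: emeasurable_funM => //; exact: (measurable_int _ intf).
- exact: emeasurable_funM.
have : ae_eq (@lebesgue_measure R) setT
   (Radon_Nikodym_SigmaFinite.f gauss1 (@lebesgue_measure R))
   (fun x => (gauss_dens x)%:E).
  apply: integral_ae_eq => // E _ mE.
  rewrite -Radon_Nikodym_SigmaFinite.f_integral//.
  by rewrite gauss_densE.
by apply: filterS => x /= h _; rewrite h// muleC.
Qed.

(* As in [gauss_int], the coordinates of index at least [n] are zero. *)
Fixpoint gaussn (n : nat) : probability (rseq R) R :=
  match n with
  | 0 => \d_((fun=> 0) : rseq R)
  | n'.+1 => distribution (gauss1 \x gaussn n')%E scons_pair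
  end.

Lemma integral_gaussn0 (f : rseq R -> \bar R) : measurable_fun setT f ->
  (\int[gaussn 0]_z f z = f (fun=> 0%R))%E.
Proof. by move=> mf; rewrite /= integral_dirac// diracT mul1e. Qed.

Lemma integral_gaussnS n (f : rseq R -> \bar R) : measurable_fun setT f ->
  (forall z, 0 <= f z)%E ->
  (\int[gaussn n.+1]_z f z =
   \int[gauss1]_x \int[gaussn n]_z f (scons x z))%E.
Proof.
move=> mf f0; rewrite /= ge0_integral_distribution//.
rewrite fubini_tonelli1//.
  exact: measurableT_comp mf measurable_scons.
by move=> x; exact: f0.
Qed.

(** Bridge from the iterated integrals of the definitions to integrals against a probability
    measure, where Tonelli and monotonicity are available. Each layer of the recursion is one
    application of Tonelli. *)
Lemma gauss_intE n (f : rseq R -> \bar R) : measurable_fun setT f ->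
  (forall z, 0 <= f z)%E -> gauss_int n f = (\int[gaussn n]_z f z)%E.
Proof.
elim: n f => [|n IHn] f mf f0; first by rewrite integral_gaussn0.
have ms := measurableT_comp mf measurable_scons.
rewrite integral_gaussnS// integral_gauss1//.
- apply: eq_integral => x _; congr (_ * _)%E; apply: IHn => //.
  exact: measurableT_comp ms (pair1_measurable _).
- apply: (measurable_fun_fubini_tonelli_F (f \o scons_pair)) => // x; exact: f0.
- by move=> x; apply: integral_ge0.
Qed.

End sequence_space.

(** * Gaussian integrals of exponentials of quadratic functions *)

Section gaussian_integrals.
Variable R : realType.
Implicit Types (a b : R).

Lemma measurable_quad a b : measurable_fun [set: R]
  (fun x : R => expR (a / 2 * x ^+ 2 + b * x)).
Proof.
apply: measurableT_comp => //; apply: measurable_funD;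
  by apply: measurable_funM => //; exact: measurable_funX.
Qed.

(** Completing the square: the tilted density is a multiple of the normal density of mean
    [b / (1 - a)] and variance [1 / (1 - a)]. *)
Lemma gauss_dens_quad a b (x : R) : a < 1 ->
  gauss_dens x * expR (a / 2 * x ^+ 2 + b * x) =
  ((Num.sqrt (1 - a))^-1 * expR (b ^+ 2 / (2 * (1 - a)))) *
  normal_pdf (b / (1 - a)) (Num.sqrt (1 - a))^-1 x.
Proof.
move=> a1; have h : 0 < 1 - a by rewrite subr_gt0.
have h0 : 1 - a != 0 by rewrite gt_eqF.
have s0 : (Num.sqrt (1 - a))^-1 != 0 by rewrite invr_eq0 gt_eqF// sqrtr_gt0.
have pp : 0 < pi *+ 2 :> R by rewrite mulrn_wgt0// pi_gt0.
rewrite normal_pdfE// /normal_peak /normal_fun /gauss_dens.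
rewrite exprVn sqr_sqrtr ?(ltW h)//.
rewrite -(mulrnAr _ pi) (@sqrtrM _ (1 - a)^-1) ?invr_ge0 ?(ltW h)//.
rewrite (@sqrtrV _ (1 - a)) ?(ltW h)// [(_ * Num.sqrt (pi *+ 2))^-1]invfM invrK.
set s := Num.sqrt (1 - a); set p := Num.sqrt (pi *+ 2).
have s1 : s != 0 by rewrite gt_eqF// sqrtr_gt0.
transitivity (p^-1 * (expR (- x ^+ 2 / 2) * expR (a / 2 * x ^+ 2 + b * x))).
  by rewrite mulrAC mulrC.
rewrite -expRD.
transitivity (p^-1 * expR (b ^+ 2 / (2 * (1 - a)) -
   (x - b / (1 - a)) ^+ 2 / ((1 - a)^-1 *+ 2))).
  congr (_ * expR _); rewrite -[(1 - a)^-1 *+ 2]mulr_natr.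
  by field; rewrite h0.
rewrite expRD -mulNr; set u := expR _; set v := expR _.
by field; rewrite s1 gt_eqF// sqrtr_gt0.
Qed.

Lemma integral_gauss1_quad a b : a < 1 ->
  (\int[gauss1 R]_x (expR (a / 2 * x ^+ 2 + b * x))%:E =
   ((Num.sqrt (1 - a))^-1 * expR (b ^+ 2 / (2 * (1 - a))))%:E)%E.
Proof.
move=> a1.
have h : 0 < 1 - a by rewrite subr_gt0.
rewrite integral_gauss1; last 2 first.
- by apply/measurable_EFinP; exact: measurable_quad.
- by move=> x; rewrite lee_fin expR_ge0.
under eq_integral do rewrite -EFinM gauss_dens_quad// EFinM.
rewrite ge0_integralZl//.
- by rewrite integral_normal_pdf mule1.
- by apply/measurable_EFinP; exact: measurable_normal_pdf.
- by move=> x _; rewrite lee_fin normal_pdf_ge0.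
Qed.

Lemma measurable_quadn n (a b : nat -> R) : measurable_fun [set: rseq R]
  (fun z : rseq R => expR (\sum_(i < n) (a i / 2 * z i ^+ 2 + b i * z i))).
Proof.
apply: measurableT_comp => //; apply: measurable_sum => i.
apply: measurable_funD; apply: measurable_funM => //; last exact: measurable_coord.
by apply: measurable_funX; exact: measurable_coord.
Qed.

(** The source of all explicit values below. The case [a = 0] averages over the disorder, [b = 0]
    gives the tilted norms, and both together handle the linearised overlap. *)
Lemma integral_gaussn_quad n (a b : nat -> R) : (forall i, a i < 1) ->
  (\int[gaussn R n]_z
     (expR (\sum_(i < n) (a i / 2 * z i ^+ 2 + b i * z i)))%:E =
   (\prod_(i < n) ((Num.sqrt (1 - a i))^-1 *
      expR (b i ^+ 2 / (2 * (1 - a i)))))%:E)%E.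
Proof.
elim: n a b => [|n IHn] a b a1.
  rewrite integral_gaussn0; last by apply/measurable_EFinP; exact: measurable_quadn.
  by rewrite !big_ord0 expR0.
rewrite integral_gaussnS; last 2 first.
- by apply/measurable_EFinP; exact: measurable_quadn.
- by move=> z; rewrite lee_fin expR_ge0.
rewrite big_ord_recl EFinM -integral_gauss1_quad//.
rewrite -(IHn (fun i => a i.+1) (fun i => b i.+1))//.
rewrite -ge0_integralZr//; last 2 first.
- by apply/measurable_EFinP; exact: measurable_quad.
- by apply: integral_ge0 => z _; rewrite lee_fin expR_ge0.
apply: eq_integral => x _; rewrite -ge0_integralZl//; last first.
  apply/measurable_EFinP.
  exact: (measurable_quadn n (fun i => a i.+1) (fun i => b i.+1)).
by apply: eq_integral => z _; rewrite -EFinM -expRD big_ord_recl.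
Qed.

End gaussian_integrals.

(** * Concentration *)

Section probability_integrals.
Context d d' (T : measurableType d) (T' : measurableType d') (R : realType).
Variables (P : probability T R) (Q : probability T' R).

(** A nonnegative function of zero integral vanishes almost everywhere; for a positive function this
    would make the whole space a null set, against total mass 1. *)
Lemma integral_prob_gt0 (f : T -> R) : measurable_fun setT f ->
  (forall x, 0 < f x) -> (0 < \int[P]_x (f x)%:E)%E.
Proof.
move=> mf f0; rewrite lt0e; apply/andP; split; last first.
  by apply: integral_ge0 => x _; rewrite lee_fin ltW.
apply/negP => /eqP int0.
have mEf : measurable_fun setT (EFin \o f) by apply/measurable_EFinP.
have : (\int[P]_x `|(EFin \o f) x| = 0)%E.
  by rewrite -int0; apply: eq_integral => x _; rewrite gee0_abs// lee_fin ltW.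
move=> /(ae_eq_integral_abs P measurableT mEf) [N [mN PN0 sN]].
have : (P setT <= P N)%E.
  apply: le_measure; rewrite ?inE// => x _; apply: sN => /= /(_ I) [fx0].
  by have := f0 x; rewrite fx0 ltxx.
by rewrite probability_setT PN0 lee_fin ler10.
Qed.

Lemma integral_prodM (f : T -> R) (g : T' -> R) :
  measurable_fun setT f -> measurable_fun setT g ->
  (forall x, 0 <= f x) -> (forall y, 0 <= g y) ->
  (\int[P]_x \int[Q]_y (f x * g y)%:E =
   (\int[P]_x (f x)%:E) * (\int[Q]_y (g y)%:E))%E.
Proof.
move=> mf mg f0 g0.
rewrite -ge0_integralZr//; last 3 first.
- exact/measurable_EFinP.
- by move=> x _; rewrite lee_fin.
- by apply: integral_ge0 => y _; rewrite lee_fin.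
apply: eq_integral => x _; rewrite -ge0_integralZl//; last 3 first.
- exact/measurable_EFinP.
- by move=> y _; rewrite lee_fin.
- by rewrite lee_fin.
Qed.

Lemma measurable_integral2 (f : T * T' -> R) :
  measurable_fun setT f -> (forall p, 0 <= f p) ->
  measurable_fun setT (fun x => \int[Q]_y (f (x, y))%:E)%E.
Proof.
move=> mf f0; apply: (measurable_fun_fubini_tonelli_F (EFin \o f)) => //.
exact/measurable_EFinP.
Qed.

Lemma measurable_funV (f : T -> R) : measurable_fun setT f ->
  (forall x, 0 < f x) -> measurable_fun setT (fun x => (f x)^-1).
Proof.
move=> mf f0; rewrite (_ : (fun _ => _) = fun x => expR (- ln (f x))).
  apply: measurableT_comp => //; apply: measurable_funN.
  exact: measurableT_comp.
by apply/funext => x; rewrite expRN lnK// posrE.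
Qed.

End probability_integrals.

(** * The mean of a log-Lipschitz function times the mean of its reciprocal *)

Section reciprocal_moment.
Variable R : realType.
Implicit Types c : R.

(** With [e = exp (c |t|)] the hypotheses place [r] between [1 / e] and [e], so
    [(r - e) (r - 1 / e) <= 0]; dividing by [r] gives [r + 1 / r <= e + 1 / e]. The right-hand side
    is [2 cosh (c t)], which is even in [t]. *)
Lemma recip_add_le c (r t : R) : 0 < r ->
  r <= expR (c * `|t|) -> r^-1 <= expR (c * `|t|) ->
  r + r^-1 <= expR (c * t) + expR (- c * t).
Proof.
move=> r0 h1 h2.
have -> : expR (c * t) + expR (- c * t) =
    expR (c * `|t|) + (expR (c * `|t|))^-1.
  rewrite -expRN -!mulNr; case: (ger0P t) => _ //.
  by rewrite addrC !mulrN !mulNr opprK.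
set e := expR _ in h1 h2 *; have e0 : 0 < e by exact: expR_gt0.
have h : (r - e) * (r - e^-1) <= 0.
  apply: mulr_le0_ge0; first by rewrite subr_le0.
  by rewrite subr_ge0 -[leRHS]invrK lef_pV2// posrE invr_gt0.
rewrite -subr_le0; suff -> : r + r^-1 - (e + e^-1) =
  r^-1 * ((r - e) * (r - e^-1)) by rewrite pmulr_rle0// invr_gt0.
by field; rewrite !gt_eqF.
Qed.

Lemma measurable_expR_lin c : measurable_fun [set: R] (fun x => expR (c * x)).
Proof. by apply: measurableT_comp => //; exact: measurable_funM. Qed.

Lemma integral_gauss1_lin c :
  (\int[gauss1 R]_x (expR (c * x))%:E = (expR (c ^+ 2 / 2))%:E)%E.
Proof.
have := @integral_gauss1_quad R 0 c ltr01.
rewrite subr0 sqrtr1 invr1 mul1r mulr1 => <-.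
by apply: eq_integral => x _; rewrite !mul0r add0r.
Qed.

(* Twice the left-hand side is the double integral of
   [phi x / phi y + phi y / phi x <= 2 cosh (c (x - y))]. *)
Lemma gauss1_recip c (phi : R -> R) : measurable_fun setT phi ->
  (forall x, 0 < phi x) ->
  (forall x y, phi x <= expR (c * `|x - y|) * phi y) ->
  ((\int[gauss1 R]_x (phi x)%:E) * (\int[gauss1 R]_x (phi x)^-1%:E)
     <= (expR (c ^+ 2))%:E)%E.
Proof.
move=> mphi phi0 hphi.
have mV : measurable_fun setT (fun x => (phi x)^-1) by exact: measurable_funV.
set A := (X in (X <= _)%E).
(* Nothing bounds [A] beforehand, so the halving is done by cases in the extended reals. *)
suff AA : (A + A <= (expR (c ^+ 2))%:E + (expR (c ^+ 2))%:E)%E.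
  have A0 : (0 <= A)%E.
    by apply: mule_ge0; apply: integral_ge0 => x _;
      rewrite lee_fin ?invr_ge0 ltW.
  clearbody A; case: A A0 AA => [a| |] //.
  by rewrite -!EFinD !lee_fin; lra.
have p0 x : 0 <= phi x by exact: ltW.
have pV0 x : 0 <= (phi x)^-1 by rewrite invr_ge0.
have E1 : A = (\int[gauss1 R]_x \int[gauss1 R]_y (phi x * (phi y)^-1)%:E)%E.
  by rewrite (@integral_prodM _ _ _ _ _ (gauss1 R) (gauss1 R)).
have E2 : A = (\int[gauss1 R]_x \int[gauss1 R]_y ((phi x)^-1 * phi y)%:E)%E.
  by rewrite (@integral_prodM _ _ _ _ _ (gauss1 R) (gauss1 R))// muleC.
(* For independent standard [x] and [y], [x - y] has variance 2, so [exp (b (x - y))] has mean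
   [exp (b^2)]. *)
have E3 (b : R) : ((expR (b ^+ 2))%:E = \int[gauss1 R]_x \int[gauss1 R]_y
    (expR (b * x) * expR (- b * y))%:E)%E.
  rewrite (@integral_prodM _ _ _ _ _ (gauss1 R) (gauss1 R))//.
  - rewrite !integral_gauss1_lin -EFinM -expRD; congr (expR _)%:E.
    by field.
  - exact: measurable_expR_lin.
  - exact: measurable_expR_lin.
have m2 (f g : R -> R) : measurable_fun setT f -> measurable_fun setT g ->
   measurable_fun setT (fun p : measurableTypeR R * measurableTypeR R =>
     f p.1 * g p.2).
  move=> mf mg; apply: measurable_funM.
    exact: measurableT_comp mf measurable_fst.
  exact: measurableT_comp mg measurable_snd.
have m1 (f g : R -> R) : measurable_fun setT f -> measurable_fun setT g ->
   forall x : R, measurable_fun setT (fun y : measurableTypeR R => (f x * g y)%:E).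
  by move=> mf mg x; apply/measurable_EFinP; exact: measurable_funM.
have split (f g f' g' : R -> R) :
  measurable_fun setT f -> measurable_fun setT g ->
  measurable_fun setT f' -> measurable_fun setT g' ->
  (forall x, 0 <= f x) -> (forall x, 0 <= g x) ->
  (forall x, 0 <= f' x) -> (forall x, 0 <= g' x) ->
  ((\int[gauss1 R]_x \int[gauss1 R]_y (f x * g y)%:E) +
   (\int[gauss1 R]_x \int[gauss1 R]_y (f' x * g' y)%:E) =
   \int[gauss1 R]_x \int[gauss1 R]_y (f x * g y + f' x * g' y)%:E)%E.
  move=> mf mg mf' mg' f0 g0 f'0 g'0.
  rewrite -ge0_integralD//.
  - apply: eq_integral => x _; rewrite -ge0_integralD//.
    + by move=> y _; rewrite lee_fin mulr_ge0.
    + exact: m1.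
    + by move=> y _; rewrite lee_fin mulr_ge0.
    + exact: m1.
  - by move=> x _; apply: integral_ge0 => y _; rewrite lee_fin mulr_ge0.
  - apply: (@measurable_integral2 _ _ _ _ _ (gauss1 R) (fun p => f p.1 * g p.2)).
      exact: m2.
    by move=> p; rewrite mulr_ge0.
  - by move=> x _; apply: integral_ge0 => y _; rewrite lee_fin mulr_ge0.
  - apply: (@measurable_integral2 _ _ _ _ _ (gauss1 R) (fun p => f' p.1 * g' p.2)).
      exact: m2.
    by move=> p; rewrite mulr_ge0.
(* The two copies of [A] are expanded with the roles of [x] and [y] exchanged, the two copies of the
   bound with opposite signs of [c]; both sides become single double integrals, comparable
   pointwise. *)
rewrite {1}E1 E2 split// {1}(E3 c) -(sqrrN c) (E3 (- c)) split//;
  try exact: measurable_expR_lin; try by move=> x; exact: expR_ge0.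
have me := measurable_expR_lin.
apply: ge0_le_integral => //.
- move=> x _; apply: integral_ge0 => y _.
  by rewrite lee_fin addr_ge0// mulr_ge0.
- apply: (@measurable_integral2 _ _ _ _ _ (gauss1 R)
    (fun p => phi p.1 * (phi p.2)^-1 + (phi p.1)^-1 * phi p.2)).
    apply: measurable_funD; first exact: (m2 phi (fun x => (phi x)^-1)).
    exact: (m2 (fun x => (phi x)^-1) phi).
  by move=> p; rewrite addr_ge0// mulr_ge0.
- apply: (@measurable_integral2 _ _ _ _ _ (gauss1 R)
    (fun p => expR (c * p.1) * expR (- c * p.2) +
              expR (- c * p.1) * expR (- - c * p.2))).
    apply: measurable_funD;
      first exact: (m2 (fun x => expR (c * x)) (fun x => expR (- c * x))).
    exact: (m2 (fun x => expR (- c * x)) (fun x => expR (- - c * x))).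
  by move=> p; rewrite addr_ge0// mulr_ge0// expR_ge0.
move=> x _; apply: ge0_le_integral => //.
- by move=> y _; rewrite lee_fin addr_ge0// mulr_ge0.
- apply/measurable_EFinP; apply: measurable_funD; exact: measurable_funM.
- apply/measurable_EFinP; apply: measurable_funD;
    by apply: measurable_funM => //; exact: measurable_expR_lin.
move=> y _; rewrite lee_fin.
have -> : (phi x)^-1 * phi y = (phi x * (phi y)^-1)^-1 by rewrite invfM invrK.
rewrite -!expRD.
have -> : c * x + - c * y = c * (x - y) by ring.
have -> : - c * x + - - c * y = - c * (x - y) by ring.
apply: recip_add_le; first by rewrite mulr_gt0// invr_gt0.
- by rewrite ler_pdivrMr.
- by rewrite invfM invrK mulrC ler_pdivrMr// distrC.
Qed.

(** Tensorisation by induction. Let [phi x] be the mean of [G] over the other coordinates when the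
    first is [x]. The induction hypothesis bounds the mean of [1 / G] on that slice by
    [exp (n c^2) / phi x], and [phi] inherits the Lipschitz bound in [x], so [gauss1_recip]
    contributes the last factor [exp (c^2)]. *)
Lemma gaussn_recip n c (G : rseq R -> R) : measurable_fun setT G ->
  (forall z, 0 < G z) ->
  (forall (i : nat) z w, (i < n)%N -> (forall k, k != i -> z k = w k) ->
     G z <= expR (c * `|z i - w i|) * G w) ->
  ((\int[gaussn R n]_z (G z)%:E) * (\int[gaussn R n]_z (G z)^-1%:E)
     <= (expR (n%:R * c ^+ 2))%:E)%E.
Proof.
elim: n G => [|n IHn] G mG G0 hG.
  have mV : measurable_fun setT (fun z => (G z)^-1) by exact: measurable_funV.
  rewrite !integral_gaussn0; try exact/measurable_EFinP.
  by rewrite -EFinM mulfV ?gt_eqF// mul0r expR0.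
have mV : measurable_fun setT (fun z => (G z)^-1) by exact: measurable_funV.
have V0 z : 0 < (G z)^-1 by rewrite invr_gt0.
rewrite !integral_gaussnS; try exact/measurable_EFinP;
  try by move=> z; rewrite lee_fin ltW.
pose Phi (x : measurableTypeR R) := (\int[gaussn R n]_z (G (scons x z))%:E)%E.
pose Psi (x : measurableTypeR R) := (\int[gaussn R n]_z (G (scons x z))^-1%:E)%E.
have mGs x : measurable_fun setT (fun z : rseq R => G (scons x z)).
  exact: measurableT_comp (measurableT_comp mG (@measurable_scons R))
    (pair1_measurable x).
have mVs x : measurable_fun setT (fun z : rseq R => (G (scons x z))^-1).
  exact: measurable_funV.
have Phi0 x : (0 < Phi x)%E by apply: integral_prob_gt0.
have Psi0 x : (0 < Psi x)%E by apply: integral_prob_gt0.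
set E := expR (n%:R * c ^+ 2).
have PhiPsi x : (Phi x * Psi x <= E%:E)%E.
  apply: IHn => // i z w i_n zw.
  apply: (hG i.+1 (scons x z) (scons x w)) => // -[|k] //= ki.
  exact: zw.
(* Integrability of [G] is not assumed: an infinite [Phi x] times the positive [Psi x] would
   contradict the bound on their product. *)
have Phifin x : Phi x \is a fin_num.
  rewrite ge0_fin_numE ?ltW//; rewrite ltey; apply/eqP => Phioo.
  by have := PhiPsi x; rewrite Phioo gt0_mulye// leye_eq.
pose phi x := fine (Phi x).
have PhiE x : Phi x = (phi x)%:E by rewrite fineK.
have phi0 x : 0 < phi x by rewrite -lte_fin -PhiE.
have mPhi : measurable_fun setT Phi.
  apply: (@measurable_integral2 _ _ _ _ _ (gaussn R n) (G \o @scons_pair R)).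
    exact: measurableT_comp mG (@measurable_scons R).
  by move=> p; exact: (ltW (G0 _)).
have mPsi : measurable_fun setT Psi.
  apply: (@measurable_integral2 _ _ _ _ _ (gaussn R n)
    (fun p => (G (@scons_pair R p))^-1)).
    apply: measurable_funV; last by move=> p; exact: G0.
    exact: measurableT_comp mG (@measurable_scons R).
  by move=> p; exact: (ltW (V0 _)).
have mphi : measurable_fun setT phi by exact: measurableT_comp.
have lip x y : phi x <= expR (c * `|x - y|) * phi y.
  rewrite -lee_fin EFinM -!PhiE -ge0_integralZl//.
  - apply: ge0_le_integral => //.
    + by move=> z _; rewrite lee_fin ltW.
    + exact/measurable_EFinP.
    + by apply/measurable_EFinP; exact: measurable_funM.
    + move=> z _; rewrite -EFinM lee_fin.
      apply: (hG 0%N (scons x z) (scons y z)) => // -[|k] //.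
  - exact/measurable_EFinP.
  - by move=> z _; rewrite lee_fin ltW.
have PsiE x : (Psi x <= E%:E * (phi x)^-1%:E)%E.
  have := PhiPsi x; rewrite PhiE => h.
  by rewrite -EFinM -lee_pdivlMl// in h *; rewrite mulrC EFinM.
have E0 : 0 <= E by exact: expR_ge0.
have mphiV : measurable_fun setT (fun x => (phi x)^-1).
  exact: (@measurable_funV _ (measurableTypeR R)).
apply: (@le_trans _ _ ((\int[gauss1 R]_x (phi x)%:E) *
   (E%:E * \int[gauss1 R]_x (phi x)^-1%:E))%E).
  apply: lee_pmul.
  - by apply: integral_ge0 => x _; exact: (ltW (Phi0 x)).
  - by apply: integral_ge0 => x _; exact: (ltW (Psi0 x)).
  - by under [leRHS]eq_integral do rewrite -PhiE.
  - rewrite -ge0_integralZl//.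
    + apply: ge0_le_integral => //.
      * by move=> x _; exact: (ltW (Psi0 x)).
      * by apply: emeasurable_funM => //; exact/measurable_EFinP.
      * by move=> x _; exact: PsiE.
    + exact/measurable_EFinP.
    + by move=> x _; rewrite lee_fin invr_ge0 ltW.
rewrite muleCA.
apply: (@le_trans _ _ (E%:E * (expR (c ^+ 2))%:E)%E).
  by rewrite lee_pmul2l// ?lte_fin ?expR_gt0//; exact: gauss1_recip.
by rewrite -EFinM -expRD -[in leRHS]natr1 mulrDl mul1r.
Qed.

End reciprocal_moment.

(** * Jensen's inequality in tangent-line form *)

Section log_bounds.
Context d (T : measurableType d) (R : realType).
Variable P : probability T R.

(** [X] stands for a logarithm, and the pointwise hypotheses for [ln u <= u - 1]. Taken together
    they dominate [|X|] by an integrable function, so the difference of the integrals of the two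
    parts is the integral of [X]; integrating each bound then removes the terms [U - 1] and [V - 1],
    of nonpositive mean. *)
Lemma integral_pos_neg_bounds (X U V : T -> R) (a b e : R) :
  measurable_fun setT X -> measurable_fun setT U -> measurable_fun setT V ->
  (forall x, 0 <= U x) -> (forall x, 0 <= V x) -> 0 <= e ->
  (\int[P]_x (U x)%:E <= 1)%E -> (\int[P]_x (V x)%:E <= 1)%E ->
  (forall x, X x <= a + (U x - 1)) -> (forall x, - X x <= b + e * (V x - 1)) ->
  ((- b)%:E <= \int[P]_x (Num.max (X x) 0)%:E - \int[P]_x (Num.max (- X x) 0)%:E
     <= a%:E)%E.
Proof.
move=> mX mU mV U0 V0 e0 intU intV XU XV.
have -> : (\int[P]_x (Num.max (X x) 0)%:E - \int[P]_x (Num.max (- X x) 0)%:E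
  = \int[P]_x (X x)%:E)%E.
  by rewrite [RHS]integralE; congr (_ - _)%E; apply: eq_integral => x _;
    rewrite ?funeposE ?funenegE -?EFinN EFin_max.
have iU : P.-integrable setT (EFin \o U).
  apply/integrableP; split; first exact/measurable_EFinP.
  under eq_integral do rewrite /= ger0_norm//.
  by apply: le_lt_trans intU _; exact: ltry.
have iV : P.-integrable setT (EFin \o V).
  apply/integrableP; split; first exact/measurable_EFinP.
  under eq_integral do rewrite /= ger0_norm//.
  by apply: le_lt_trans intV _; exact: ltry.
have icst (c : R) : P.-integrable setT (fun=> c%:E).
  exact: finite_measure_integrable_cst.
have intcst (c : R) : (\int[P]_(x in setT) c%:E = c%:E)%E.
  by rewrite integral_cst//= probability_setT mule1.
have iXU : P.-integrable setT (fun x => (a - 1)%:E + (U x)%:E)%E.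
  exact: integrableD (icst _) iU.
have ieV : P.-integrable setT (fun x => e%:E * (V x)%:E)%E.
  exact: integrableZl iV.
have iXV : P.-integrable setT (fun x => (b - e)%:E + e%:E * (V x)%:E)%E.
  exact: integrableD (icst _) ieV.
have iX : P.-integrable setT (EFin \o X).
  apply: (@le_integrable _ _ _ _ _ measurableT _
    (fun x => `|(a - 1)%:E + (U x)%:E| + `|(b - e)%:E + e%:E * (V x)%:E|)%E).
  - exact/measurable_EFinP.
  - move=> x _ /=; rewrite lee_fin.
    rewrite [leRHS]ger0_norm ?addr_ge0//.
    have := XU x; have := XV x.
    have := ler_norm (a - 1 + U x); have := ler_norm (b - e + e * V x).
    have := normr_ge0 (a - 1 + U x); have := normr_ge0 (b - e + e * V x).
    set A := `|a - 1 + U x|; set B := `|b - e + e * V x| => *.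
    by rewrite ler_norml; apply/andP; split; lra.
  - by apply: integrableD => //; exact: integrable_abse.
apply/andP; split.
  apply: (@le_trans _ _ (\int[P]_x ((e - b)%:E + (- e)%:E * (V x)%:E))%E).
    rewrite integralD//; last exact: integrableZl.
    rewrite intcst integralZl//.
    have -> : ((- b)%:E = (e - b)%:E + (- e)%:E * 1)%E.
      by rewrite mule1 -EFinD addrAC subrr sub0r.
    by rewrite leeD2l// !EFinN !mulNe leeN2 lee_wpmul2l.
  apply: le_integral => //.
    by apply: integrableD => //; exact: integrableZl.
  by move=> x _; rewrite -EFinM -EFinD lee_fin; have := XV x; lra.
apply: (@le_trans _ _ (\int[P]_x ((a - 1)%:E + (U x)%:E))%E).
  apply: le_integral => //.
  by move=> x _; rewrite -EFinD lee_fin; have := XU x; lra.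
rewrite integralD// intcst.
have -> : (a%:E = (a - 1)%:E + 1)%E by rewrite -EFinD subrK.
by rewrite leeD2l.
Qed.

End log_bounds.

(** * Negative moments from a second moment estimate *)

Section negative_moment.
Variable R : realType.

(** Here [u^s >= min (1, u)] whatever [s] in (0, 1]. For [u <= 1] this gives [t u <= u^s]; for
    [u > 1] the square [(t u - 2)^2 >= 0] gives [t u <= 1 + t^2 u^2 / 4]. The bound is therefore
    uniform in [s]. *)
Lemma expR_ln_ge_quad (s t u : R) : 0 < s -> s <= 1 -> 0 <= t -> t <= 1 -> 0 < u ->
  t * u <= expR (s * ln u) + t ^+ 2 / 4 * u ^+ 2.
Proof.
move=> s0 s1 t0 t1 u0.
have [u1|u1] := leP u 1.
  have : u <= expR (s * ln u).
    rewrite -[leLHS]lnK ?posrE// ler_expR.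
    have : ln u <= 0 by exact: ln_le0.
    by nra.
  have := sqr_ge0 (t * u); nra.
have : 1 <= expR (s * ln u).
  rewrite -[leLHS]expR0 ler_expR; apply: mulr_ge0; first exact: ltW.
  by apply: ln_ge0; exact: ltW.
have := sqr_ge0 (t * u - 2); nra.
Qed.

(** [gaussn_recip] is applied to [G = (Y / m)^s], whose logarithm is [s c]-Lipschitz in each
    variable. It bounds the mean of [1 / G] as soon as the mean of [G] is bounded below, which the
    second moment of [Y] provides. *)
Lemma neg_moment n (c s K m : R) (Y : rseq R -> R) :
  measurable_fun setT Y -> (forall g, 0 < Y g) ->
  (forall (i : nat) z w, (i < n)%N -> (forall k, k != i -> z k = w k) ->
     Y z <= expR (c * `|z i - w i|) * Y w) ->
  0 < s -> s <= 1 -> 1 <= K -> 0 < m ->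
  (\int[gaussn R n]_g (Y g)%:E = m%:E)%E ->
  (\int[gaussn R n]_g (Y g ^+ 2)%:E <= (K * m ^+ 2)%:E)%E ->
  (\int[gaussn R n]_g (expR (- (s * ln (Y g / m))))%:E
    <= (4 * K / 3 * expR (n%:R * (s * c) ^+ 2))%:E)%E.
Proof.
move=> mY Y0 lipY s0 s1 K1 m0 EY EY2.
have u0 g : 0 < Y g / m by rewrite divr_gt0.
have mu : measurable_fun setT (fun g => Y g / m).
  exact: measurable_funM.
pose G (g : rseq R) := expR (s * ln (Y g / m)).
have mG : measurable_fun setT G.
  apply: measurableT_comp => //; apply: measurable_funM => //.
  exact: measurableT_comp.
have G0 g : 0 < G g by exact: expR_gt0.
have K0 : 0 < K by exact: lt_le_trans K1.
have rec := @gaussn_recip R n (s * c) G mG G0.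
have {}rec := rec _.
have /rec : forall (i : nat) (z w : rseq R), (i < n)%N ->
  (forall k : nat, k != i -> z k = w k) ->
  G z <= expR (s * c * `|z i - w i|) * G w.
  move=> i z w i_n zw; rewrite /G -expRD ler_expR -mulrA -mulrDr ler_pM2l//.
  rewrite -ler_expR expRD !lnK ?posrE//.
  by rewrite mulrA ler_pM2r ?invr_gt0//; exact: lipY.
have -> : (\int[gaussn R n]_z (G z)^-1%:E =
   \int[gaussn R n]_g (expR (- (s * ln (Y g / m))))%:E)%E.
  by apply: eq_integral => g _; rewrite expRN.
set I := (\int[_]_g (expR (- _))%:E)%E => h.
have GK : ((3 / (4 * K))%:E <= \int[gaussn R n]_z (G z)%:E)%E.
  (* With [u = Y / m] of mean 1 and second moment at most [K], the mean of [u^s] is at least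
     [t - K t^2 / 4]. The choice [t = 1 / K] is admissible because [K >= 1] and yields
     [3 / (4 K)]. *)
  pose t := K^-1.
  have t0 : 0 <= t by rewrite invr_ge0 ltW.
  have t1 : t <= 1 by rewrite invf_le1.
  have Eu : (\int[gaussn R n]_g (t * (Y g / m))%:E = t%:E)%E.
    under eq_integral do rewrite mulrC mulrAC -mulrA mulrC EFinM.
    rewrite ge0_integralZl//; last 3 first.
    - exact/measurable_EFinP.
    - by move=> g _; rewrite lee_fin ltW.
    - by rewrite lee_fin divr_ge0// ltW.
    by rewrite EY -EFinM divfK ?gt_eqF.
  have Eu2 : (\int[gaussn R n]_g (t ^+ 2 / 4 * (Y g / m) ^+ 2)%:E
      <= (t / 4)%:E)%E.
    under eq_integral => g _.
      have -> : t ^+ 2 / 4 * (Y g / m) ^+ 2 = t ^+ 2 / (4 * m ^+ 2) * Y g ^+ 2.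
        by field; rewrite gt_eqF.
      rewrite EFinM; over.
    rewrite ge0_integralZl//; last 3 first.
    - by apply/measurable_EFinP; exact: measurable_funX.
    - by move=> g _; rewrite lee_fin sqr_ge0.
    - by rewrite lee_fin divr_ge0// ?sqr_ge0// mulr_ge0// sqr_ge0.
    apply: (@le_trans _ _ ((t ^+ 2 / (4 * m ^+ 2))%:E * (K * m ^+ 2)%:E)%E).
      apply: lee_wpmul2l => //.
      by rewrite lee_fin divr_ge0// ?sqr_ge0// mulr_ge0// sqr_ge0.
    rewrite -EFinM lee_fin le_eqVlt; apply/orP; left; apply/eqP.
    by rewrite /t; field; rewrite !gt_eqF.
  have : (\int[gaussn R n]_g (t * (Y g / m))%:E <=
     \int[gaussn R n]_g ((G g)%:E + (t ^+ 2 / 4 * (Y g / m) ^+ 2)%:E))%E.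
    apply: ge0_le_integral => //.
    - by move=> g _; rewrite lee_fin mulr_ge0// ltW.
    - by apply/measurable_EFinP; exact: measurable_funM.
    - apply: emeasurable_funD; first exact/measurable_EFinP.
      apply/measurable_EFinP; apply: measurable_funM => //.
      exact: measurable_funX.
    - by move=> g _; rewrite -EFinD lee_fin expR_ln_ge_quad.
  rewrite ge0_integralD//; last 4 first.
  - by move=> g _; rewrite lee_fin ltW.
  - exact/measurable_EFinP.
  - by move=> g _; rewrite lee_fin mulr_ge0 ?sqr_ge0// divr_ge0 ?sqr_ge0.
  - apply/measurable_EFinP; apply: measurable_funM => //.
    exact: measurable_funX.
  rewrite Eu; move/le_trans => /(_ _ (leeD2l _ Eu2)).
  have -> : 3 / (4 * K) = t - t / 4 by rewrite /t; field; rewrite gt_eqF.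
  by rewrite EFinB leeBlDr.
have I0 : (0 <= I)%E by apply: integral_ge0 => g _; rewrite lee_fin expR_ge0.
have : ((3 / (4 * K))%:E * I <= (expR (n%:R * (s * c) ^+ 2))%:E)%E.
  by apply: le_trans h; exact: lee_wpmul2r.
rewrite muleC -lee_pdivlMr ?divr_gt0 ?mulr_gt0// => /le_trans; apply.
rewrite -EFinM lee_fin le_eqVlt; apply/orP; left; apply/eqP.
by field; rewrite gt_eqF.
Qed.

End negative_moment.

(** * Moments of the partition function *)

Section SK_moments.
Variable R : realType.
Implicit Types (beta lambda : R) (N : nat) (z w g : rseq R).

Definition sqnorm N (z : nat -> R) := \sum_(i < N) z i ^+ 2.
Definition dotp N (z w : nat -> R) := \sum_(i < N) z i * w i.
(** The exponent is affine in the disorder, and this is the coefficient of [g k]; division with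
    remainder undoes the indexing [k = i * N + j] of [J_of]. *)
Definition coupling beta N (z : nat -> R) (k : nat) :=
  beta / Num.sqrt (N%:R *+ 2) * (z (k %/ N)%N * z (k %% N)%N).
Definition SK_weight beta lambda N (g z : nat -> R) :=
  expR (SK_exponent beta lambda N (J_of N g) z).

Lemma sum_divmod (V : nmodType) M N (F : nat -> nat -> V) :
  \sum_(i < M) \sum_(j < N) F i j = \sum_(k < M * N) F (k %/ N)%N (k %% N)%N.
Proof.
elim: M => [|M IHM]; first by rewrite !big_ord0.
rewrite big_ord_recr/= IHM -!(big_mkord xpredT (fun k => F (k %/ N)%N (k %% N)%N)).
rewrite (@big_cat_nat _ _ _ (M * N) 0 (M.+1 * N))//=; last by rewrite leq_mul.
congr (_ + _); rewrite -[X in \sum_(X <= _ < _) _]add0n big_addn mulSnr addKn big_mkord.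
apply: eq_bigr => i _; have N0 : (0 < N)%N by apply: leq_ltn_trans (ltn_ord i).
by rewrite addnC divnMDl// divn_small// addn0 modnMDl modn_small.
Qed.

(** Covariance of the linear parts of the exponent at [z] and [w]: the double sum over index pairs
    factors, which leaves the squared overlap. *)
Lemma coupling_dot beta N z w : (0 < N)%N ->
  \sum_(k < N * N) coupling beta N z k * coupling beta N w k =
  beta ^+ 2 / (N%:R *+ 2) * dotp N z w ^+ 2.
Proof.
move=> N0; rewrite [dotp N z w ^+ 2]expr2 /dotp big_distrlr/=.
rewrite (sum_divmod N N (fun i j => z i * w i * (z j * w j))) mulr_sumr.
apply: eq_bigr => k _; rewrite /coupling.
have -> : beta ^+ 2 / (N%:R *+ 2) = (beta / Num.sqrt (N%:R *+ 2)) ^+ 2.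
  by rewrite expr_div_n sqr_sqrtr// mulrn_wge0.
ring.
Qed.

Lemma dotpp N z : dotp N z z = sqnorm N z.
Proof. by apply: eq_bigr => i _; rewrite expr2. Qed.

Lemma SK_exponentE beta lambda N g z :
  SK_exponent beta lambda N (J_of N g) z =
  \sum_(k < N * N) coupling beta N z k * g k +
  (lambda / 2 * sqnorm N z - beta ^+ 2 / (N%:R *+ 4) * sqnorm N z ^+ 2).
Proof.
rewrite /SK_exponent [in RHS]addrA -[in RHS]addrA -addrA; congr (_ + _); last first.
  by rewrite addrC.
rewrite (sum_divmod N N (fun i j => J_of N g i j * z i * z j)) mulr_sumr.
apply: eq_bigr => k _; rewrite /J_of /coupling -divn_eq; ring.
Qed.

Lemma integral_disorder n (b : nat -> R) (e : R) :
  (\int[gaussn R n]_g (expR (\sum_(k < n) b k * g k + e))%:E =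
   (expR (\sum_(k < n) b k * b k / 2 + e))%:E)%E.
Proof.
have mb : measurable_fun setT (fun g : rseq R => expR (\sum_(k < n) b k * g k)).
  apply: measurableT_comp => //; apply: measurable_sum => k.
  by apply: measurable_funM => //; exact: measurable_coord.
under eq_integral do rewrite expRD EFinM.
rewrite ge0_integralZr//; last exact/measurable_EFinP.
rewrite expRD EFinM; congr (_ * _)%E.
transitivity (\int[gaussn R n]_z
     (expR (\sum_(i < n) (0 / 2 * z i ^+ 2 + b i * z i)))%:E)%E.
  apply: eq_integral => g _; congr (expR _)%:E; apply: eq_bigr => k _.
  by rewrite !mul0r add0r.
rewrite (@integral_gaussn_quad R n (fun=> 0) b (fun=> ltr01)).
rewrite expR_sum; congr (_%:E); apply: eq_bigr => k _.
by rewrite subr0 sqrtr1 invr1 mul1r mulr1 expr2.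
Qed.

(** Half the variance of the linear part is [beta^2 |z|^4 / (4 N)], exactly the quartic term
    subtracted in the exponent. *)
Lemma SK_moment1 beta lambda N z : (0 < N)%N ->
  (\int[gaussn R (N * N)]_g (SK_weight beta lambda N g z)%:E =
   (expR (lambda / 2 * sqnorm N z))%:E)%E.
Proof.
move=> N0; have n0 : (N%:R : R) != 0 by rewrite pnatr_eq0 -lt0n.
under eq_integral do rewrite /SK_weight SK_exponentE.
rewrite integral_disorder; congr (expR _)%:E.
rewrite -mulr_suml coupling_dot// dotpp.
rewrite -[N%:R *+ 2]mulr_natr -[N%:R *+ 4]mulr_natr.
by field.
Qed.

(** The quartic terms cancel as in [SK_moment1], and only the cross covariance survives. The factor
    depending on [z] alone is kept apart because [w] is integrated first. *)
Lemma SK_moment2 beta lambda N z w : (0 < N)%N ->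
  (\int[gaussn R (N * N)]_g
     (SK_weight beta lambda N g z * SK_weight beta lambda N g w)%:E =
   (expR (lambda / 2 * sqnorm N z) * expR (lambda / 2 * sqnorm N w +
      beta ^+ 2 / (N%:R *+ 2) * dotp N z w ^+ 2))%:E)%E.
Proof.
move=> N0; have n0 : (N%:R : R) != 0 by rewrite pnatr_eq0 -lt0n.
pose e z := lambda / 2 * sqnorm N z - beta ^+ 2 / (N%:R *+ 4) * sqnorm N z ^+ 2.
transitivity (\int[gaussn R (N * N)]_g
  (expR (\sum_(k < N * N) (coupling beta N z k + coupling beta N w k) * g k +
    (e z + e w)))%:E)%E.
  apply: eq_integral => g _; congr (_%:E).
  rewrite /SK_weight !SK_exponentE -expRD addrACA -big_split/=.
  by congr (expR (_ + _)); apply: eq_bigr => k _; rewrite mulrDl.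
rewrite (integral_disorder _ (fun k => coupling beta N z k + coupling beta N w k)).
rewrite -expRD; congr (expR _)%:E.
rewrite -mulr_suml.
under eq_bigr do rewrite mulrDl !mulrDr.
rewrite !big_split/= !coupling_dot// !dotpp.
have -> : dotp N w z = dotp N z w by apply: eq_bigr => i _; rewrite mulrC.
rewrite /e -[N%:R *+ 2]mulr_natr -[N%:R *+ 4]mulr_natr.
by field.
Qed.

Lemma measurable_sqnorm N : measurable_fun setT (fun z : rseq R => sqnorm N z).
Proof.
apply: measurable_sum => i; apply: measurable_funX; exact: measurable_coord.
Qed.

Lemma measurable_SK_weight beta lambda N : measurable_fun setT
  (fun p : rseq R * rseq R => SK_weight beta lambda N p.1 p.2).
Proof.
have -> : (fun p : rseq R * rseq R => SK_weight beta lambda N p.1 p.2) =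
    fun p => expR (\sum_(k < N * N) coupling beta N p.2 k * p.1 k +
     (lambda / 2 * sqnorm N p.2 -
      beta ^+ 2 / (N%:R *+ 4) * sqnorm N p.2 ^+ 2)).
  by apply/funext => p; rewrite /SK_weight SK_exponentE.
have m2 k : measurable_fun setT (fun p : rseq R * rseq R => p.2 k).
  exact: measurableT_comp (measurable_coord k) measurable_snd.
have m1 k : measurable_fun setT (fun p : rseq R * rseq R => p.1 k).
  exact: measurableT_comp (measurable_coord k) measurable_fst.
have mq : measurable_fun setT (fun p : rseq R * rseq R => sqnorm N p.2).
  exact: measurableT_comp (measurable_sqnorm N) measurable_snd.
apply: measurableT_comp => //; apply: measurable_funD.
  apply: measurable_sum => k; apply: measurable_funM => //.
  by apply: measurable_funM => //; exact: measurable_funM.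
apply: measurable_funB; first exact: measurable_funM.
by apply: measurable_funM => //; exact: measurable_funX.
Qed.

Lemma coord_sq_le N z (i : nat) : (i < N)%N -> z i ^+ 2 <= sqnorm N z.
Proof.
move=> iN; rewrite /sqnorm (bigD1 (Ordinal iN))//= lerDl.
by apply: sumr_ge0 => j _; exact: sqr_ge0.
Qed.

(** For fixed disorder the linear part is at most a constant times [|z|^2], by [|z_i z_j| <= |z|^2],
    and the quartic term dominates it; [C] is the maximum of [a x - b x^2]. Finiteness of the
    partition function for every [g] follows. *)
Lemma SK_weight_bounded beta lambda N g : 0 < beta -> (0 < N)%N ->
  exists C : R, forall z, SK_weight beta lambda N g z <= C.
Proof.
move=> beta0 N0.
have n0 : 0 < N%:R :> R by rewrite ltr0n.
pose s := \sum_(k < N * N) `|g k|.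
pose k0 := beta / Num.sqrt (N%:R *+ 2).
have k00 : 0 <= k0 by rewrite divr_ge0// ltW.
pose a := k0 * s + lambda / 2; pose b := beta ^+ 2 / (N%:R *+ 4).
have b0 : 0 < b by rewrite divr_gt0// ?exprn_gt0// mulrn_wgt0.
exists (expR (a ^+ 2 / (4 * b))) => z.
rewrite /SK_weight ler_expR SK_exponentE.
apply: (@le_trans _ _ (a * sqnorm N z - b * sqnorm N z ^+ 2)).
  rewrite /a mulrDl -addrA lerD2r.
  rewrite /s [k0 * _]mulr_sumr [leRHS]mulr_suml; apply: ler_sum => k _.
  rewrite /coupling -/k0 -!(mulrA k0); apply: ler_wpM2l => //.
  have kN : (k %/ N < N)%N by rewrite ltn_divLR.
  have kmN : (k %% N < N)%N by rewrite ltn_mod.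
  have h1 := coord_sq_le z kN; have h2 := coord_sq_le z kmN.
  set x := z (k %/ N)%N in h1 *; set y := z (k %% N)%N in h2 *.
  apply: (le_trans (ler_norm _)); rewrite !normrM mulrC.
  apply: ler_wpM2l => //.
  have : 0 <= (`|x| - `|y|) ^+ 2 by exact: sqr_ge0.
  by rewrite sqrrB !real_normK ?num_real// -mulr_natr; nra.
rewrite -subr_ge0.
have -> : a ^+ 2 / (4 * b) - (a * sqnorm N z - b * sqnorm N z ^+ 2) =
  (a - 2 * b * sqnorm N z) ^+ 2 / (4 * b) by field; rewrite gt_eqF.
by rewrite divr_ge0 ?sqr_ge0// mulr_ge0// ltW.
Qed.

End SK_moments.

(** * The partition function with a cutoff: moments, positivity, Lipschitz bound *)

Section partition_function.
Variable R : realType.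
Implicit Types (beta lambda : R) (N : nat) (z w g : rseq R).

Lemma measurable_SK_weight2 beta lambda N g :
  measurable_fun setT (fun z : rseq R => SK_weight beta lambda N g z).
Proof.
exact: measurableT_comp (@measurable_SK_weight R beta lambda N) (pair1_measurable g).
Qed.

Lemma measurable_SK_weight1 beta lambda N z :
  measurable_fun setT (fun g : rseq R => SK_weight beta lambda N g z).
Proof.
exact: measurableT_comp (@measurable_SK_weight R beta lambda N) (pair2_measurable z).
Qed.

Lemma Z_NE beta lambda N g : Z_N beta lambda N (J_of N g) =
  (\int[gaussn R N]_z (SK_weight beta lambda N g z)%:E)%E.
Proof.
rewrite /Z_N -gauss_intE//.
- by apply/measurable_EFinP; exact: measurable_SK_weight2.
- by move=> z; rewrite lee_fin expR_ge0.
Qed.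

Lemma integral_expR_sqnorm N (a : R) : a < 1 ->
  (\int[gaussn R N]_z (expR (a / 2 * sqnorm N z))%:E =
   ((Num.sqrt (1 - a))^-1 ^+ N)%:E)%E.
Proof.
move=> a1.
transitivity (\int[gaussn R N]_z
     (expR (\sum_(i < N) (a / 2 * z i ^+ 2 + 0 * z i)))%:E)%E.
  apply: eq_integral => z _; congr (expR _)%:E; rewrite mulr_sumr.
  by apply: eq_bigr => i _; rewrite mul0r addr0.
rewrite (@integral_gaussn_quad R N (fun=> a) (fun=> 0) (fun=> a1)).
under eq_bigr do rewrite expr0n/= mul0r expR0 mulr1.
by rewrite big_const_ord iter_mulr_1.
Qed.

(* Hubbard-Stratonovich: the square of the overlap is linearised by an
   auxiliary standard Gaussian [x], which decouples the coordinates of [w]. *)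
Lemma integral_overlap beta lambda N z : (0 < N)%N -> lambda < 1 ->
  0 < beta -> beta < 1 - lambda -> sqnorm N z <= N%:R / beta ->
  (\int[gaussn R N]_w (expR (lambda / 2 * sqnorm N w +
      beta ^+ 2 / (N%:R *+ 2) * dotp N z w ^+ 2))%:E <=
   ((Num.sqrt (1 - lambda))^-1 ^+ N *
    (Num.sqrt (1 - beta / (1 - lambda)))^-1)%:E)%E.
Proof.
move=> N0 l1 b0 bl zN.
have n0 : 0 < N%:R :> R by rewrite ltr0n.
have l0 : 0 < 1 - lambda by rewrite subr_gt0.
pose c := beta / Num.sqrt N%:R.
have c2 : c ^+ 2 = beta ^+ 2 / N%:R by rewrite expr_div_n sqr_sqrtr// ltW.
pose f (p : rseq R * measurableTypeR R) :=
  expR (lambda / 2 * sqnorm N p.1 + c * dotp N z p.1 * p.2).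
have mf : measurable_fun setT f.
  apply: measurableT_comp => //; apply: measurable_funD.
    apply: measurable_funM => //.
    exact: measurableT_comp (measurable_sqnorm N) measurable_fst.
  apply: measurable_funM => //.
  apply: measurable_funM => //; apply: measurable_sum => i.
  apply: measurable_funM => //.
  exact: measurableT_comp (measurable_coord i) measurable_fst.
have f0 p : (0 <= (f p)%:E)%E by rewrite lee_fin expR_ge0.
have -> : (\int[gaussn R N]_w (expR (lambda / 2 * sqnorm N w +
      beta ^+ 2 / (N%:R *+ 2) * dotp N z w ^+ 2))%:E =
  \int[gaussn R N]_w \int[gauss1 R]_x (f (w, x))%:E)%E.
  apply: eq_integral => w _; rewrite /f/=.
  under eq_integral do rewrite expRD EFinM.
  rewrite ge0_integralZl//; last first.
    by apply/measurable_EFinP; exact: measurable_expR_lin.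
  rewrite integral_gauss1_lin -EFinM -expRD; congr (expR (_ + _))%:E.
  rewrite exprMn c2 -mulr_natr; field.
  by rewrite gt_eqF.
rewrite (fubini_tonelli (EFin \o f))//; last exact/measurable_EFinP.
(* Integrating out [w] leaves the exponent [beta^2 x^2 |z|^2 / (2 N (1 - lambda))], at most
   [a x^2 / 2] when [|z|^2 <= N / beta]. The Gaussian integral over [x] converges because
   [a < 1]. *)
pose a := beta / (1 - lambda).
have a1 : a < 1 by rewrite ltr_pdivrMr// mul1r.
have A0 : 0 <= (Num.sqrt (1 - lambda))^-1 ^+ N :> R.
  by rewrite exprn_ge0// invr_ge0.
have -> : ((Num.sqrt (1 - lambda))^-1 ^+ N * (Num.sqrt (1 - a))^-1)%:E =
  (\int[gauss1 R]_x ((Num.sqrt (1 - lambda))^-1 ^+ N *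
      expR (a / 2 * x ^+ 2 + 0 * x))%:E)%E.
  under eq_integral do rewrite EFinM.
  rewrite ge0_integralZl//; last first.
    by apply/measurable_EFinP; exact: measurable_quad.
  rewrite integral_gauss1_quad//.
  by rewrite expr0n/= mul0r expR0 mulr1.
apply: ge0_le_integral => //.
- by move=> x _; apply: integral_ge0 => w _; exact: (f0 (w, x)).
- apply: (measurable_fun_fubini_tonelli_G (EFin \o f)) => //.
  exact/measurable_EFinP.
- apply/measurable_EFinP; apply: measurable_funM => //; exact: measurable_quad.
move=> x _ /=.
have -> : (\int[gaussn R N]_w (f (w, x))%:E = \int[gaussn R N]_w
   (expR (\sum_(i < N) (lambda / 2 * w i ^+ 2 + c * x * z i * w i)))%:E)%E.
  apply: eq_integral => w _; congr (expR _)%:E; rewrite big_split/= -mulr_sumr.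
  congr (_ + _); rewrite mulrAC mulr_sumr.
  by apply: eq_bigr => i _; rewrite !mulrA.
rewrite (@integral_gaussn_quad R N (fun=> lambda) (fun i => c * x * z i) (fun=> l1)).
rewrite big_split/= big_const_ord iter_mulr_1 lee_fin ler_wpM2l//.
rewrite mul0r addr0 -expR_sum ler_expR.
under eq_bigr do rewrite exprMn.
rewrite -mulr_suml -mulr_sumr -/(sqnorm N z) exprMn c2.
have -> : beta ^+ 2 / N%:R * x ^+ 2 * sqnorm N z / (2 * (1 - lambda)) =
  (beta ^+ 2 * x ^+ 2 / (2 * (1 - lambda) * N%:R)) * sqnorm N z.
  by field; rewrite !gt_eqF.
apply: (@le_trans _ _ ((beta ^+ 2 * x ^+ 2 / (2 * (1 - lambda) * N%:R)) * (N%:R / beta))).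
  apply: ler_wpM2l => //; apply: divr_ge0; first by apply: mulr_ge0; exact: sqr_ge0.
  by apply: mulr_ge0; [apply: mulr_ge0 => //|]; exact: ltW.
rewrite le_eqVlt; apply/orP; left; apply/eqP.
by rewrite /a; field; rewrite !gt_eqF.
Qed.

(** A general cutoff covers both [Z] (constant 1) and its restriction [Y] (an indicator). By
    [truncZE], [fine] acts on a finite value for cutoffs between 0 and 1. *)
Definition truncZ (chi : rseq R -> R) beta lambda N g : R :=
  fine (\int[gaussn R N]_z (chi z * SK_weight beta lambda N g z)%:E)%E.

Section truncated.
Variables (chi : rseq R -> R) (beta lambda : R) (N : nat).
Hypotheses (mchi : measurable_fun setT chi) (chi0 : forall z, 0 <= chi z)
  (chi1 : forall z, chi z <= 1) (beta0 : 0 < beta) (N0 : (0 < N)%N).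

Let F (p : rseq R * rseq R) := chi p.2 * SK_weight beta lambda N p.1 p.2.

Let mF : measurable_fun setT F.
Proof.
apply: measurable_funM; last exact: measurable_SK_weight.
exact: measurableT_comp mchi measurable_snd.
Qed.

Let F0 p : 0 <= F p.
Proof. by rewrite mulr_ge0 ?expR_ge0. Qed.

Let mF2 g : measurable_fun setT (fun z : rseq R => F (g, z)).
Proof. exact: measurableT_comp mF (pair1_measurable g). Qed.

Let mF1 z : measurable_fun setT (fun g : rseq R => F (g, z)).
Proof. exact: measurableT_comp mF (pair2_measurable z). Qed.

Lemma truncZE g : (truncZ chi beta lambda N g)%:E =
  (\int[gaussn R N]_z (chi z * SK_weight beta lambda N g z)%:E)%E.
Proof.
rewrite fineK// ge0_fin_numE; last first.
  by apply: integral_ge0 => z _; rewrite lee_fin; exact: (F0 (g, z)).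
have [C hC] := @SK_weight_bounded R beta lambda N g beta0 N0.
apply: (@le_lt_trans _ _ (\int[gaussn R N]_(z in setT) C%:E)%E).
  apply: ge0_le_integral => //.
  - by move=> z _; rewrite lee_fin; exact: (F0 (g, z)).
  - by apply/measurable_EFinP; exact: mF2.
  - move=> z _; rewrite lee_fin.
    apply: (@le_trans _ _ (SK_weight beta lambda N g z)); last exact: hC.
    by rewrite -[leRHS]mul1r ler_wpM2r// expR_ge0.
by rewrite integral_cst//= probability_setT mule1 ltry.
Qed.

Lemma truncZ_ge0 g : 0 <= truncZ chi beta lambda N g.
Proof.
rewrite -lee_fin truncZE; apply: integral_ge0 => z _; exact: (F0 (g, z)).
Qed.

Lemma measurable_truncZ : measurable_fun setT (truncZ chi beta lambda N).
Proof.
apply: measurableT_comp => //.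
exact: (@measurable_integral2 _ _ _ _ _ (gaussn R N) F).
Qed.

Lemma truncZ_moment1 :
  (\int[gaussn R (N * N)]_g (truncZ chi beta lambda N g)%:E =
   \int[gaussn R N]_z (chi z * expR (lambda / 2 * sqnorm N z))%:E)%E.
Proof.
under eq_integral do rewrite truncZE.
rewrite (fubini_tonelli (EFin \o F))//; last exact/measurable_EFinP.
apply: eq_integral => z _ /=; rewrite /F/=.
under eq_integral do rewrite EFinM.
rewrite ge0_integralZl//; last 3 first.
- by apply/measurable_EFinP; exact: measurable_SK_weight1.
- by move=> g _; rewrite lee_fin expR_ge0.
- by rewrite lee_fin.
by rewrite SK_moment1// EFinM.
Qed.

(** Write the square as a double integral over [z] and [w] and average over the disorder first. The
    cutoff is kept on [z], where it makes [integral_overlap] applicable, and bounded by 1 on [w].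
    One factor of the bound is the first moment itself, which makes the comparison with its square
    possible. *)
Lemma truncZ_moment2 : lambda < 1 -> beta < 1 - lambda ->
  (forall z, chi z != 0 -> sqnorm N z <= N%:R / beta) ->
  (\int[gaussn R (N * N)]_g (truncZ chi beta lambda N g ^+ 2)%:E <=
   (\int[gaussn R N]_z (chi z * expR (lambda / 2 * sqnorm N z))%:E) *
   ((Num.sqrt (1 - lambda))^-1 ^+ N *
    (Num.sqrt (1 - beta / (1 - lambda)))^-1)%:E)%E.
Proof.
move=> l1 bl hchi; set K := (_ * _^-1).
have K0 : 0 <= K by rewrite mulr_ge0 ?exprn_ge0 ?invr_ge0.
pose Y := truncZ chi beta lambda N.
have mY : measurable_fun setT Y by exact: measurable_truncZ.
have Y0 g : 0 <= Y g by exact: truncZ_ge0.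
pose H (p : rseq R * rseq R) := F p * Y p.1.
have mH : measurable_fun setT H.
  apply: measurable_funM => //; exact: measurableT_comp mY measurable_fst.
have H0 p : 0 <= H p by rewrite mulr_ge0.
have -> : (\int[gaussn R (N * N)]_g (Y g ^+ 2)%:E =
  \int[gaussn R (N * N)]_g \int[gaussn R N]_z (H (g, z))%:E)%E.
  apply: eq_integral => g _; rewrite expr2 EFinM {1}/Y truncZE.
  rewrite -ge0_integralZr//.
  - by apply: eq_integral => z _; rewrite -truncZE.
  - by apply/measurable_EFinP; exact: (mF2 g).
  - by move=> z _; rewrite lee_fin; exact: (F0 (g, z)).
  - by apply: integral_ge0 => z _; rewrite lee_fin; exact: (F0 (g, z)).
rewrite (fubini_tonelli (EFin \o H))//; last exact/measurable_EFinP.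
have me : measurable_fun setT (fun z : rseq R => expR (lambda / 2 * sqnorm N z)).
  by apply: measurableT_comp => //; apply: measurable_funM => //;
    exact: measurable_sqnorm.
rewrite -ge0_integralZr//; last 2 first.
- by apply/measurable_EFinP; exact: measurable_funM.
- by move=> z _; rewrite lee_fin mulr_ge0 ?expR_ge0.
apply: ge0_le_integral => //.
- by move=> z _; apply: integral_ge0 => g _; rewrite lee_fin.
- apply: (measurable_fun_fubini_tonelli_G (EFin \o H)) => //.
  exact/measurable_EFinP.
- by apply/measurable_EFinP; apply: measurable_funM => //; exact: measurable_funM.
move=> z _ /=.
have [chiz|chiz] := eqVneq (chi z) 0.
  rewrite chiz !mul0r mul0e.
  under eq_integral do rewrite /H /F/= chiz !mul0r.
  by rewrite integral0.
pose G (p : rseq R * rseq R) := F (p.1, z) * F p.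
have mG : measurable_fun setT G.
  apply: measurable_funM => //; exact: measurableT_comp (mF1 z) measurable_fst.
have G0 p : 0 <= G p by rewrite mulr_ge0.
have -> : (\int[gaussn R (N * N)]_g (H (g, z))%:E =
  \int[gaussn R (N * N)]_g \int[gaussn R N]_w (G (g, w))%:E)%E.
  apply: eq_integral => g _; rewrite /H /= EFinM {1}/Y truncZE.
  rewrite -ge0_integralZl//.
  - by apply/measurable_EFinP; exact: (mF2 g).
  - by move=> w _; rewrite lee_fin; exact: (F0 (g, w)).
  - by rewrite lee_fin.
rewrite (fubini_tonelli (EFin \o G))//; last exact/measurable_EFinP.
pose ov w := expR (lambda / 2 * sqnorm N w +
      beta ^+ 2 / (N%:R *+ 2) * dotp N z w ^+ 2).
have mov : measurable_fun setT ov.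
  apply: measurableT_comp => //; apply: measurable_funD.
    by apply: measurable_funM => //; exact: measurable_sqnorm.
  apply: measurable_funM => //; apply: measurable_funX.
  apply: measurable_sum => i; apply: measurable_funM => //.
  exact: measurable_coord.
apply: (@le_trans _ _ (\int[gaussn R N]_w
   (chi z * expR (lambda / 2 * sqnorm N z) * ov w)%:E)%E).
  apply: ge0_le_integral => //.
  - by move=> w _; apply: integral_ge0 => g _; rewrite lee_fin.
  - apply: (measurable_fun_fubini_tonelli_G (EFin \o G)) => //.
    exact/measurable_EFinP.
  - by apply/measurable_EFinP; exact: measurable_funM.
  move=> w _ /=.
  have -> : (\int[gaussn R (N * N)]_g (G (g, w))%:E = (chi z * chi w)%:E *
    \int[gaussn R (N * N)]_g
     (SK_weight beta lambda N g z * SK_weight beta lambda N g w)%:E)%E.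
    rewrite -ge0_integralZl//.
    - by apply: eq_integral => g _; rewrite -EFinM /G /F/= mulrACA.
    - apply/measurable_EFinP; apply: measurable_funM;
        exact: measurable_SK_weight1.
    - by move=> g _; rewrite lee_fin mulr_ge0// expR_ge0.
    - by rewrite lee_fin mulr_ge0.
  rewrite SK_moment2// -EFinM lee_fin -/(ov w) mulrACA.
  rewrite mulrACA -[leRHS]mulr1 mulrAC mulrA mulrC.
  rewrite [leRHS]mulrC; apply: ler_pM => //.
  by rewrite !mulr_ge0 ?expR_ge0.
under eq_integral do rewrite EFinM.
have c0 : 0 <= chi z * expR (lambda / 2 * sqnorm N z).
  by rewrite mulr_ge0 ?expR_ge0.
rewrite ge0_integralZl//; last 2 first.
- exact/measurable_EFinP.
- by move=> w _; rewrite lee_fin expR_ge0.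
by apply: lee_wpmul2l; [rewrite lee_fin|apply: integral_overlap => //; exact: hchi].
Qed.

(** The weight is positive everywhere, so a vanishing integral forces [chi = 0] almost everywhere,
    contradicting the positive mean. The conclusion holds for every [g], as needed to take
    logarithms. *)
Lemma truncZ_gt0 g :
  (0 < \int[gaussn R N]_z (chi z * expR (lambda / 2 * sqnorm N z))%:E)%E ->
  0 < truncZ chi beta lambda N g.
Proof.
move=> h; rewrite lt_neqAle truncZ_ge0 andbT; apply/eqP => Z0.
have : (\int[gaussn R N]_z `|(EFin \o (fun z => F (g, z))) z| = 0)%E.
  rewrite -[RHS]/(0%:E) Z0 truncZE; apply: eq_integral => z _.
  by rewrite gee0_abs// lee_fin.
move=> /ae_eq_integral_abs => /(_ measurableT) ae0.
have {}ae0 := ae0 ((measurable_EFinP _ _).2 (mF2 g)).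
suff e0 : (\int[gaussn R N]_z (chi z * expR (lambda / 2 * sqnorm N z))%:E = 0)%E.
  by rewrite e0 ltxx in h.
rewrite -(integral0 (gaussn R N) setT); apply: ae_eq_integral => //.
  apply/measurable_EFinP; apply: measurable_funM => //.
  by apply: measurableT_comp => //; apply: measurable_funM => //;
    exact: measurable_sqnorm.
apply: filterS ae0 => z /= /(_ I) [] /eqP.
rewrite mulf_eq0 => /orP[/eqP -> _|]; first by rewrite mul0r.
by rewrite gt_eqF ?expR_gt0.
Qed.

(** Changing [g i] moves the exponent by [coupling beta N z i * (g i - g' i)], and on the support of
    [chi] the product of two coordinates of [z] is at most [T] in absolute value. *)
Lemma truncZ_lipschitz (T : R) (i : nat) g g' : 0 <= T ->
  (forall z, chi z != 0 -> forall j, (j < N)%N -> z j ^+ 2 <= T) ->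
  (i < N * N)%N -> (forall k, k != i -> g k = g' k) ->
  truncZ chi beta lambda N g <=
  expR (beta / Num.sqrt (N%:R *+ 2) * T * `|g i - g' i|) *
  truncZ chi beta lambda N g'.
Proof.
move=> T0 hchi iN gg'; set e := expR _.
have e0 : 0 <= e by exact: expR_ge0.
rewrite -lee_fin EFinM !truncZE -ge0_integralZl//; last 2 first.
- by apply/measurable_EFinP; exact: (mF2 g').
- by move=> z _; rewrite lee_fin; exact: (F0 (g', z)).
apply: ge0_le_integral => //.
- by move=> z _; rewrite lee_fin; exact: (F0 (g, z)).
- by apply/measurable_EFinP; exact: (mF2 g).
- by apply/measurable_EFinP; apply: measurable_funM => //; exact: (mF2 g').
move=> z _; rewrite -EFinM lee_fin mulrCA.
have [->|chiz] := eqVneq (chi z) 0; first by rewrite !mul0r.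
apply: ler_wpM2l => //; rewrite -expRD ler_expR !SK_exponentE [leRHS]addrA lerD2r.
rewrite -lerBlDr -sumrB (bigD1 (Ordinal iN))//= big1 ?addr0; last first.
  by move=> k ki; rewrite gg' ?subrr//.
rewrite -mulrBr /coupling -!(mulrA (beta / _)); apply: ler_wpM2l.
  by rewrite divr_ge0// ltW.
have h1 : z (i %/ N)%N ^+ 2 <= T by apply: hchi => //; rewrite ltn_divLR.
have h2 : z (i %% N)%N ^+ 2 <= T by apply: hchi => //; rewrite ltn_mod.
apply: (le_trans (ler_norm _)); rewrite normrM; apply: ler_wpM2r => //.
set x := z (i %/ N)%N in h1 *; set y := z (i %% N)%N in h2 *.
have : 0 <= (`|x| - `|y|) ^+ 2 by exact: sqr_ge0.
by rewrite normrM sqrrB !real_normK ?num_real// -mulr_natr; nra.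
Qed.

End truncated.

End partition_function.

(** * Truncation *)

Section truncation.
Variable R : realType.
Implicit Types (beta lambda theta : R) (N : nat) (z w g : rseq R).

(* The threshold [N / beta] lies above the value [N / (1 - lambda)] of [|z|^2]
   typical under the tilted Gaussian, and below [N (1 - lambda) / beta^2], past
   which the second moment of the truncated partition function diverges. *)
Definition bulk beta (T : R) N : set (rseq R) :=
  [set z | sqnorm N z <= N%:R / beta] `&`
  \bigcap_(j in [set j | (j < N)%N]) [set z | z j ^+ 2 <= T].

Lemma measurable_bulk beta T N : measurable (bulk beta T N).
Proof.
apply: measurableI.
  rewrite -[X in measurable X]setTI; apply: measurable_fun_le => //.
  exact: measurable_sqnorm.
apply: bigcap_measurableType => j _.
rewrite -[X in measurable X]setTI; apply: measurable_fun_le => //.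
by apply: measurable_funX; exact: measurable_coord.
Qed.

Lemma indic_bulk_neq0 beta T N z : \1_(bulk beta T N) z != 0 :> R ->
  sqnorm N z <= N%:R / beta /\ forall j, (j < N)%N -> z j ^+ 2 <= T.
Proof.
rewrite indicE; have [|] := boolP (z \in _); last by rewrite eqxx.
by rewrite inE => -[h1 h2] _; split => // j jN; exact: h2.
Qed.

(** A pointwise Chernoff and union bound: off the bulk some constraint fails, and the corresponding
    exponential is at least 1. *)
Lemma bulk_tail beta T N theta z : 0 < theta ->
  1 <= \1_(bulk beta T N) z + expR (theta / 2 * (sqnorm N z - N%:R / beta)) +
       \sum_(i < N) expR (theta / 2 * (z i ^+ 2 - T)).
Proof.
move=> t0; set s := \sum_(i < N) _.
have s0 : 0 <= s by apply: sumr_ge0 => i _; exact: expR_ge0.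
have e0 := expR_ge0 (theta / 2 * (sqnorm N z - N%:R / beta)).
rewrite indicE; have [_|] := boolP (z \in _); first by rewrite mulr1n; lra.
rewrite mulr0n add0r.
rewrite notin_setE => /not_andP /= [/negP|].
  rewrite -ltNge => h; have : 1 <= expR (theta / 2 * (sqnorm N z - N%:R / beta)).
    by rewrite -[leLHS]expR0 ler_expR mulr_ge0 ?divr_ge0 ?subr_ge0// ltW.
  by lra.
move=> /existsNP[j] /not_implyP[jN] /negP; rewrite -ltNge => h.
have : 1 <= s.
  rewrite /s (bigD1 (Ordinal jN))//=; set u := \sum_(_ < _ | _) _.
  have u0 : 0 <= u by apply: sumr_ge0 => i _; exact: expR_ge0.
  have : 1 <= expR (theta / 2 * (z j ^+ 2 - T)).
    by rewrite -[leLHS]expR0 ler_expR mulr_ge0 ?divr_ge0 ?subr_ge0// ltW.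
  by lra.
by lra.
Qed.

Lemma integral_expR_sqnorm_coord N (i : 'I_N) lambda theta :
  0 <= theta -> lambda + theta < 1 ->
  (\int[gaussn R N]_z (expR (lambda / 2 * sqnorm N z + theta / 2 * z i ^+ 2))%:E =
   ((Num.sqrt (1 - lambda))^-1 ^+ N *
    (Num.sqrt (1 - lambda) / Num.sqrt (1 - (lambda + theta))))%:E)%E.
Proof.
move=> t0 lt1; have l1 : lambda < 1 by lra.
pose a (j : nat) := lambda + (if j == i then theta else 0).
have a1 j : a j < 1 by rewrite /a; case: ifP => _; lra.
transitivity (\int[gaussn R N]_z
     (expR (\sum_(j < N) (a j / 2 * z j ^+ 2 + 0 * z j)))%:E)%E.
  apply: eq_integral => z _; congr (expR _)%:E.
  under [RHS]eq_bigr do rewrite mul0r addr0 /a mulrDl mulrDl.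
  rewrite big_split/= mulr_sumr; congr (_ + _).
  rewrite (bigD1 i)//= eqxx big1 ?addr0// => j ji.
  by rewrite -val_eqE/= in ji; rewrite (negbTE ji) !mul0r.
rewrite (@integral_gaussn_quad R N a (fun=> 0) a1); congr (_%:E).
under eq_bigr do rewrite expr0n/= mul0r expR0 mulr1.
have s0 : Num.sqrt (1 - lambda) != 0 by rewrite gt_eqF// sqrtr_gt0 subr_gt0.
transitivity (\prod_(j < N) ((Num.sqrt (1 - lambda))^-1 *
   (if j == i then Num.sqrt (1 - lambda) / Num.sqrt (1 - (lambda + theta)) else 1))).
  apply: eq_bigr => j _; rewrite /a val_eqE.
  by case: eqP => _; [rewrite mulKf|rewrite addr0 mulr1].
rewrite big_split/= big_const_ord iter_mulr_1; congr (_ * _).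
rewrite (bigD1 i)//= eqxx big1 ?mulr1// => j ji.
by rewrite (negbTE ji).
Qed.

(** [bulk_tail] integrated against the tilt [exp (lambda |z|^2 / 2)]. A violated norm constraint
    raises the tilt to [lambda + theta] in all coordinates, hence an [N]-th power; a violated
    coordinate constraint raises it in one coordinate, hence a factor [N]. *)
Lemma bulk_mass beta lambda theta T N : 0 < theta -> lambda + theta < 1 ->
  (((Num.sqrt (1 - lambda))^-1 ^+ N)%:E <=
   (\int[gaussn R N]_z (\1_(bulk beta T N) z * expR (lambda / 2 * sqnorm N z))%:E) +
   ((Num.sqrt (1 - lambda))^-1 ^+ N *
     ((expR (- (theta / (2 * beta))) *
       (Num.sqrt (1 - lambda) / Num.sqrt (1 - (lambda + theta)))) ^+ N +
      N%:R * (expR (- (theta / 2 * T)) *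
       (Num.sqrt (1 - lambda) / Num.sqrt (1 - (lambda + theta))))))%:E)%E.
Proof.
move=> t0 lt1; have l1 : lambda < 1 by lra.
have sl0 : Num.sqrt (1 - lambda) != 0 by rewrite gt_eqF// sqrtr_gt0 subr_gt0.
rewrite -integral_expR_sqnorm//.
set chi := (\1_(bulk beta T N) : rseq R -> R).
have mchi : measurable_fun setT chi by apply: measurable_indic; exact: measurable_bulk.
have chi0 z : 0 <= chi z by rewrite /chi indicE.
have me a : measurable_fun setT (fun z : rseq R => expR (a * sqnorm N z)).
  by apply: measurableT_comp => //; apply: measurable_funM => //;
    exact: measurable_sqnorm.
pose h i (z : rseq R) := expR (lambda / 2 * sqnorm N z + theta / 2 * z i ^+ 2).
have mh i : measurable_fun setT (h i).
  apply: measurableT_comp => //; apply: measurable_funD.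
    by apply: measurable_funM => //; exact: measurable_sqnorm.
  by apply: measurable_funM => //; apply: measurable_funX; exact: measurable_coord.
pose c1 := expR (- (theta / (2 * beta)) * N%:R).
pose c2 := expR (- (theta / 2 * T)).
have c10 : (0 <= c1%:E)%E by rewrite lee_fin expR_ge0.
have c20 : (0 <= c2%:E)%E by rewrite lee_fin expR_ge0.
apply: (@le_trans _ _ (\int[gaussn R N]_z
   ((chi z * expR (lambda / 2 * sqnorm N z))%:E +
    (c1%:E * (expR ((lambda + theta) / 2 * sqnorm N z))%:E +
     c2%:E * \sum_(i < N) (h i z)%:E)))%E).
  apply: ge0_le_integral => //.
  - by apply/measurable_EFinP; exact: me.
  - apply: emeasurable_funD; first by apply/measurable_EFinP; exact: measurable_funM.
    apply: emeasurable_funD.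
      by apply/measurable_EFinP; exact: measurable_funM.
    apply: emeasurable_funM => //; apply: emeasurable_sum => i.
    by apply/measurable_EFinP; exact: mh.
  move=> z _; rewrite sumEFin -!EFinM -!EFinD lee_fin.
  have := bulk_tail beta T N z t0; rewrite -/chi => hz.
  have e0 := expR_gt0 (lambda / 2 * sqnorm N z).
  rewrite -[leLHS]mul1r.
  apply: (le_trans (ler_wpM2r (ltW e0) hz)).
  rewrite [leLHS]mulrDl [X in X + _]mulrDl -[leLHS]addrA lerD2l.
  have -> : expR (theta / 2 * (sqnorm N z - N%:R / beta)) *
      expR (lambda / 2 * sqnorm N z) =
      c1 * expR ((lambda + theta) / 2 * sqnorm N z).
    rewrite /c1 -!expRD; congr expR; rewrite invfM.
    ring.
  rewrite lerD2l [leLHS]mulr_suml [leRHS]mulr_sumr; apply: ler_sum => i _.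
  by rewrite /c2 /h -!expRD ler_expR le_eqVlt; apply/orP; left; apply/eqP; ring.
rewrite ge0_integralD//; last 4 first.
- by move=> z _; rewrite lee_fin mulr_ge0// expR_ge0.
- by apply/measurable_EFinP; exact: measurable_funM.
- move=> z _; apply: adde_ge0; first by rewrite -EFinM lee_fin mulr_ge0// expR_ge0.
  rewrite sumEFin -EFinM lee_fin mulr_ge0 ?expR_ge0// sumr_ge0// => i _.
  exact: expR_ge0.
- apply: emeasurable_funD; first by apply/measurable_EFinP; exact: measurable_funM.
  apply: emeasurable_funM => //; apply: emeasurable_sum => i.
  by apply/measurable_EFinP; exact: mh.
rewrite leeD2l// ge0_integralD//; last 4 first.
- by move=> z _; rewrite -EFinM lee_fin mulr_ge0// expR_ge0.
- by apply/measurable_EFinP; exact: measurable_funM.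
- move=> z _.
  rewrite sumEFin -EFinM lee_fin mulr_ge0 ?expR_ge0// sumr_ge0// => i _.
  exact: expR_ge0.
- apply: emeasurable_funM => //; apply: emeasurable_sum => i.
  by apply/measurable_EFinP; exact: mh.
rewrite ge0_integralZl//; last first.
  by apply/measurable_EFinP; exact: me.
rewrite integral_expR_sqnorm// ge0_integralZl//; last 2 first.
- by apply: emeasurable_sum => i; apply/measurable_EFinP; exact: mh.
- by move=> z _; rewrite sumEFin lee_fin sumr_ge0// => i _; exact: expR_ge0.
rewrite ge0_integral_sum//; last 2 first.
- by move=> i; apply/measurable_EFinP; exact: mh.
- by move=> i z _; rewrite lee_fin expR_ge0.
under eq_bigr do rewrite integral_expR_sqnorm_coord ?ltW//.
rewrite sumEFin -!EFinM -EFinD lee_fin sumr_const card_ord.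
rewrite le_eqVlt; apply/orP; left; apply/eqP.
rewrite /c1 -/c2 mulrC expRM_natr -mulr_natl !exprMn !exprVn.
set d := Num.sqrt (1 - lambda) in sl0 *; set f := Num.sqrt _.
have dN : d ^+ N != 0 by rewrite expf_neq0.
rewrite mulrDr; congr (_ + _); last by ring.
by rewrite [RHS]mulrCA mulKf// mulrC.
Qed.

End truncation.

(** * Quenched pressure *)

Section quenched_pressure.
Variable R : realType.
Implicit Types (beta lambda : R) (N : nat) (g : rseq R).

Lemma ln_le_sub1 (x : R) : 0 < x -> ln x <= x - 1.
Proof.
move=> x0; have := @le_ln1Dx _ (x - 1); rewrite addrCA subrr addr0; apply.
by rewrite ltrBrDl subrr.
Qed.

Lemma logZE beta lambda N g :
  logZ beta lambda N g = ln (truncZ (cst 1) beta lambda N g).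
Proof.
rewrite /logZ Z_NE /truncZ; congr (ln (fine _)).
by apply: eq_integral => z _; rewrite mul1r.
Qed.

Lemma le_truncZ (chi : rseq R -> R) beta lambda N g :
  measurable_fun setT chi -> (forall z, 0 <= chi z) -> (forall z, chi z <= 1) ->
  0 < beta -> (0 < N)%N ->
  truncZ chi beta lambda N g <= truncZ (cst 1) beta lambda N g.
Proof.
move=> mchi chi0 chi1 b0 N0; rewrite -lee_fin !truncZE//.
apply: ge0_le_integral => //.
- by move=> z _; rewrite lee_fin mulr_ge0// expR_ge0.
- apply/measurable_EFinP; apply: measurable_funM => //.
  exact: measurable_SK_weight2.
- apply/measurable_EFinP; apply: measurable_funM => //.
  exact: measurable_SK_weight2.
- by move=> z _; rewrite lee_fin ler_wpM2r// expR_ge0.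
Qed.

(** The upper bound is Jensen's inequality for [Z], of mean [A ^+ N]. For the lower bound [Z >= Y],
    and [ln Y] is controlled by the negative moment of order [s] of [Y / m], [m] being the mean of
    [Y]. *)
Lemma ElogZ_bounds (chi : rseq R -> R) beta lambda N (T c s : R) :
  measurable_fun setT chi -> (forall z, 0 <= chi z) -> (forall z, chi z <= 1) ->
  lambda < 1 -> 0 < beta -> beta < 1 - lambda -> (0 < N)%N -> 0 <= T ->
  (forall z, chi z != 0 -> sqnorm N z <= N%:R / beta) ->
  (forall z, chi z != 0 -> forall j, (j < N)%N -> z j ^+ 2 <= T) ->
  0 < c -> c <= 1 -> 0 < s -> s <= 1 ->
  let A := (Num.sqrt (1 - lambda))^-1 in
  ((c * A ^+ N)%:E <=
    \int[gaussn R N]_z (chi z * expR (lambda / 2 * sqnorm N z))%:E)%E ->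
  ((N%:R * ln A + ln c - s^-1 * (ln (4 / 3 * ((Num.sqrt (1 - beta / (1 - lambda)))^-1 / c))
     + beta ^+ 2 / 2 * N%:R * s ^+ 2 * T ^+ 2))%:E
   <= ElogZ beta lambda N <= (N%:R * ln A)%:E)%E.
Proof.
move=> mchi chi0 chi1 l1 b0 bl N0 T0 hchi1 hchi2 c0 c1 s0 s1 A hm.
have l0 : 0 < 1 - lambda by rewrite subr_gt0.
have n0 : 0 < N%:R :> R by rewrite ltr0n.
have A0 : 0 < A by rewrite invr_gt0 sqrtr_gt0.
have AN0 : 0 < A ^+ N by rewrite exprn_gt0.
set K := (Num.sqrt (1 - _ / _))^-1.
have u1 : 0 < 1 - beta / (1 - lambda).
  by rewrite subr_gt0 ltr_pdivrMr// mul1r.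
have K1 : 1 <= K.
  rewrite /K invf_ge1 ?sqrtr_gt0// -[leRHS]sqrtr1 ler_sqrt//.
  by rewrite gerBl divr_ge0// ltW.
have Kc1 : 1 <= K / c by rewrite ler_pdivlMr// mul1r (le_trans c1).
pose n := (N * N)%N.
pose Y g := truncZ chi beta lambda N g.
pose Z g := truncZ (cst 1) beta lambda N g.
have mY : measurable_fun setT Y by exact: measurable_truncZ.
have mZ : measurable_fun setT Z by apply: measurable_truncZ.
have EZ : (\int[gaussn R n]_g (Z g)%:E = (A ^+ N)%:E)%E.
  rewrite truncZ_moment1// -integral_expR_sqnorm//.
  by apply: eq_integral => z _; rewrite mul1r.
have YZ g : Y g <= Z g by exact: le_truncZ.
have EY : (\int[gaussn R n]_g (Y g)%:E =
    \int[gaussn R N]_z (chi z * expR (lambda / 2 * sqnorm N z))%:E)%E.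
  by rewrite truncZ_moment1.
have EYpos : (0 < \int[gaussn R N]_z (chi z * expR (lambda / 2 * sqnorm N z))%:E)%E.
  by apply: lt_le_trans hm; rewrite lte_fin mulr_gt0.
have Y0 g : 0 < Y g by exact: truncZ_gt0.
have Z0 g : 0 < Z g by exact: lt_le_trans (YZ g).
have EYfin : (\int[gaussn R n]_g (Y g)%:E)%E \is a fin_num.
  rewrite ge0_fin_numE; last by apply: integral_ge0 => g _; rewrite lee_fin ltW.
  apply: (@le_lt_trans _ _ (A ^+ N)%:E); last exact: ltry.
  rewrite -EZ; apply: ge0_le_integral => //.
  - by move=> g _; rewrite lee_fin ltW.
  - exact/measurable_EFinP.
  - exact/measurable_EFinP.
  - by move=> g _; rewrite lee_fin.
pose m := fine (\int[gaussn R n]_g (Y g)%:E)%E.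
have mE : (\int[gaussn R n]_g (Y g)%:E = m%:E)%E by rewrite fineK.
have cm : c * A ^+ N <= m by rewrite -lee_fin -mE EY.
have m0 : 0 < m by apply: lt_le_trans cm; rewrite mulr_gt0.
(* The second moment is at most [m * A ^+ N * K], and [A ^+ N <= m / c] by the assumed lower bound
   on the mean. *)
have EY2 : (\int[gaussn R n]_g (Y g ^+ 2)%:E <= (K / c * m ^+ 2)%:E)%E.
  apply: (le_trans (truncZ_moment2 mchi chi0 chi1 b0 N0 l1 bl hchi1)).
  rewrite -EY mE -EFinM lee_fin -/K.
  have -> : K / c * m ^+ 2 = m * (m * K / c) by field; rewrite gt_eqF.
  rewrite ler_pM2l// ler_pdivlMr// mulrAC ler_pM2r ?(lt_le_trans ltr01 K1)//.
  by rewrite mulrC.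
pose k := beta / Num.sqrt (N%:R *+ 2) * T.
have lipY (i : nat) (z w : rseq R) : (i < n)%N ->
  (forall k, k != i -> z k = w k) -> Y z <= expR (k * `|z i - w i|) * Y w.
  by move=> i_n zw; exact: truncZ_lipschitz.
have nm := neg_moment mY Y0 lipY s0 s1 Kc1 m0 mE EY2.
set Q := 4 * (K / c) / 3 * expR (n%:R * (s * k) ^+ 2) in nm.
have Q0 : 0 < Q.
  by rewrite mulr_gt0 ?expR_gt0// divr_gt0// mulr_gt0// (lt_le_trans ltr01 Kc1).
(* [U] and [V] are normalised to have mean at most 1. Applied to [V], [ln x <= x - 1] solved for
   [ln (Y g)] is the required lower bound with slope [s^-1]. *)
pose V g := expR (- (s * ln (Y g / m))) / Q.
pose U g := Z g / A ^+ N.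
have mlnY : measurable_fun setT (fun g => expR (- (s * ln (Y g / m)))).
  apply: measurableT_comp => //; apply: measurable_funN.
  apply: measurable_funM => //; apply: measurableT_comp => //.
  exact: measurable_funM.
have mX : measurable_fun setT (logZ beta lambda N : rseq R -> R).
  rewrite (_ : logZ beta lambda N = fun g => ln (Z g)); last first.
    by apply/funext => g; rewrite logZE.
  exact: measurableT_comp.
have := @integral_pos_neg_bounds _ _ R (gaussn R n) (logZ beta lambda N) U V
  (N%:R * ln A) (- (ln m - s^-1 * ln Q)) s^-1 mX.
case/(_ _ _ _ _ _ _ _ _ _)/andP.
- exact: measurable_funM.
- exact: measurable_funM.
- by move=> g; rewrite divr_ge0// ltW.
- by move=> g; rewrite divr_ge0 ?expR_ge0// ltW.
- by rewrite invr_ge0 ltW.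
- rewrite /U; under eq_integral do rewrite EFinM.
  rewrite ge0_integralZr//.
  + by rewrite EZ -EFinM mulfV// gt_eqF.
  + exact/measurable_EFinP.
  + by move=> g _; rewrite lee_fin ltW.
  + by rewrite lee_fin invr_ge0 ltW.
- rewrite /V; under eq_integral do rewrite EFinM.
  rewrite ge0_integralZr//.
  + apply: (@le_trans _ _ (Q%:E * Q^-1%:E)%E).
      by apply: lee_wpmul2r => //; rewrite lee_fin invr_ge0 ltW.
    by rewrite -EFinM mulfV// gt_eqF.
  + exact/measurable_EFinP.
  + by rewrite lee_fin invr_ge0 ltW.
- move=> g; rewrite logZE -/(Z g).
  have -> : ln (Z g) = ln (A ^+ N) + ln (U g).
    rewrite -lnM ?posrE//; last by rewrite divr_gt0.
    by rewrite /U mulrC divfK// gt_eqF.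
  rewrite lnXn// mulr_natl lerD2l.
  by apply: ln_le_sub1; rewrite divr_gt0.
- move=> g; rewrite logZE -/(Z g).
  have lnYZ : ln (Y g) <= ln (Z g) by rewrite ler_ln ?posrE.
  have V0 : 0 < V g by rewrite divr_gt0 ?expR_gt0.
  have lnV := ln_le_sub1 V0.
  have lnVE : ln (V g) = - (s * (ln (Y g) - ln m)) - ln Q.
    by rewrite /V ln_div ?posrE ?expR_gt0// expRK ln_div ?posrE.
  have h : s^-1 * ln (V g) = - (ln (Y g) - ln m) - s^-1 * ln Q.
    by rewrite lnVE mulrBr mulrN mulKf// gt_eqF.
  have h2 : s^-1 * ln (V g) <= s^-1 * (V g - 1).
    by rewrite ler_pM2l// invr_gt0.
  by lra.
move=> lo hi.
have EE : ElogZ beta lambda N =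
  (\int[gaussn R n]_x (Num.max (logZ beta lambda N x) 0)%:E -
   \int[gaussn R n]_x (Num.max (- logZ beta lambda N x) 0)%:E)%E.
  rewrite /ElogZ !gauss_intE//.
  - apply/measurable_EFinP; apply: measurable_maxr => //; exact: measurable_funN.
  - by move=> g; rewrite lee_fin le_max lexx orbT.
  - by apply/measurable_EFinP; apply: measurable_maxr.
  - by move=> g; rewrite lee_fin le_max lexx orbT.
rewrite EE hi andbT; apply: le_trans lo; rewrite opprK lee_fin.
have lm : N%:R * ln A + ln c <= ln m.
  rewrite mulr_natl -lnXn// addrC -lnM ?posrE// ler_ln ?posrE//.
  by rewrite mulr_gt0.
apply: lerB => //; rewrite ler_pM2l ?invr_gt0// /Q lnM ?posrE ?expR_gt0//; last first.
  by rewrite divr_gt0// mulr_gt0// (lt_le_trans ltr01 Kc1).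
rewrite expRK; apply: lerD.
  by rewrite le_eqVlt; apply/orP; left; apply/eqP; congr ln; ring.
(* There are [N^2] disorder variables, each with squared constant [beta^2 T^2 / (2 N)], so one power
   of [N] remains. *)
rewrite /k exprMn exprMn exprMn exprVn sqr_sqrtr ?mulrn_wge0//.
rewrite /n natrM -[N%:R *+ 2]mulr_natr le_eqVlt; apply/orP; left; apply/eqP.
by field; rewrite gt_eqF.
Qed.

End quenched_pressure.

(** * The fourth root of N *)

Section fourth_root.
Variable R : realType.

Definition root4 (N : nat) : R := Num.sqrt (Num.sqrt N%:R).

Lemma root4_exp N : root4 N ^+ 4 = N%:R.
Proof. by rewrite (exprM _ 2 2) !sqr_sqrtr. Qed.

Lemma root4_ge (x : R) : \forall N \near \oo, x <= root4 N.
Proof.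
near=> N.
have [x0|x0] := leP x 0; first by rewrite (le_trans x0)// sqrtr_ge0.
rewrite -(@ler_pXn2r _ 4)// ?nnegrE ?sqrtr_ge0 ?(ltW x0)// root4_exp.
by near: N; exact: nbhs_infty_ger.
Unshelve. all: by end_near. Qed.

Lemma cvg_root4V : (root4 N)^-1 @[N --> \oo] --> (0 : R).
Proof.
apply/cvgrVy.
  near=> N; rewrite invr_gt0; apply: (@lt_le_trans _ _ 1) => //.
  by near: N; exact: root4_ge.
apply/cvgryPge => x; near=> N.
by rewrite /unstable.inv_fun invrK; near: N; exact: root4_ge.
Unshelve. all: by end_near. Qed.

(** One term of the exponential series, with [120 = 5!]. The fifth power is the first to beat the
    factor [N = r^4] of the union bound, where [r = root4 N]. *)
Lemma expRN_le_exp5 (x : R) : 0 < x -> expR (- x) <= 120 / x ^+ 5.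
Proof.
move=> x0; have h := @expR_ge1Dxn R x 4 (ltW x0).
rewrite expRN -[leRHS]invrK lef_pV2 ?posrE ?expR_gt0//; last first.
  by rewrite invr_gt0 divr_gt0// exprn_gt0.
rewrite invf_div (_ : 5`!%:R = 120 :> R)//.
by apply: le_trans h; rewrite lerDr.
Qed.

End fourth_root.
Arguments root4 {R} N.

Theorem mainTheorem7 (R : realType) (beta lambda : R) :
  lambda < 1 -> 0 < beta -> beta < 1 - lambda ->
  (fun N : nat => ((N%:R)^-1)%:E * ElogZ beta lambda N)%E @ \oo -->
    ((- ln (1 - lambda) / 2)%:E : \bar R).
Proof.
move=> l1 b0 bl.
have l0 : 0 < 1 - lambda by rewrite subr_gt0.
pose A : R := (Num.sqrt (1 - lambda))^-1.
have A0 : 0 < A by rewrite invr_gt0 sqrtr_gt0.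
have lnA : ln A = - ln (1 - lambda) / 2.
  rewrite /A lnV ?posrE ?sqrtr_gt0// -{2}(@sqr_sqrtr _ (1 - lambda)) ?(ltW l0)//.
  by rewrite lnXn ?sqrtr_gt0// -mulr_natr; field.
(* Every [theta] strictly between 0 and [1 - lambda - beta] would give [q < 1] below; the midpoint
   maximises the gap [theta (1 - lambda - beta - theta) / beta] that appears there. *)
pose theta := (1 - lambda - beta) / 2.
have t0 : 0 < theta by rewrite divr_gt0// subr_gt0.
have lt1 : lambda + theta < 1 by rewrite /theta; lra.
have lt0 : 0 < 1 - (lambda + theta) by rewrite subr_gt0.
pose D : R := Num.sqrt (1 - lambda) / Num.sqrt (1 - (lambda + theta)).
have D0 : 0 < D by rewrite divr_gt0 ?sqrtr_gt0.
pose q := expR (- (theta / (2 * beta))) * D.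
have q0 : 0 < q by rewrite mulr_gt0 ?expR_gt0.
(* Squaring removes the roots, and [exp y >= 1 + y] at [y = theta / beta] reduces the claim to a
   polynomial inequality. *)
have q1 : q < 1.
  rewrite -(@ltr_pXn2r _ 2)// ?nnegrE ?(ltW q0)// expr1n.
  rewrite exprMn -expRM_natl expr_div_n !sqr_sqrtr ?(ltW l0) ?(ltW lt0)//.
  have -> : 2%:R * - (theta / (2 * beta)) = - (theta / beta).
    by field; rewrite gt_eqF.
  rewrite expRN mulrC mulrAC -mulrA -invfM ltr_pdivrMr ?mulr_gt0 ?expR_gt0// mul1r.
  apply: (@lt_le_trans _ _ ((1 - (lambda + theta)) * (1 + theta / beta))); last first.
    by rewrite mulrC ler_pM2r// expR_ge1Dx.
  rewrite -subr_gt0.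
  have -> : (1 - (lambda + theta)) * (1 + theta / beta) - (1 - lambda) =
    (1 - lambda - beta) ^+ 2 / (4 * beta).
    by rewrite /theta; field; rewrite gt_eqF.
  by rewrite divr_gt0 ?exprn_gt0 ?subr_gt0// mulr_gt0.
(* The bulk carries at least the fraction [1 - q^N - c] of the mass once the coordinate term is at
   most [c]; since [q^N <= q], this is at least [1 - q - c = c]. *)
pose c := (1 - q) / 2.
have c0 : 0 < c by rewrite divr_gt0// subr_gt0.
have c1 : c <= 1 by rewrite /c; lra.
pose L := ln (4 / 3 * ((Num.sqrt (1 - beta / (1 - lambda)))^-1 / c)).
pose C := `|L| + beta ^+ 2 / 2 - ln c.
have key : \forall N \near \oo,
  ((ln A - C * (root4 N)^-1)%:E <= (N%:R^-1)%:E * ElogZ beta lambda N <= (ln A)%:E)%E.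
  near=> N.
  have r1 : 1 <= root4 N :> R by near: N; exact: root4_ge.
  (* By [expRN_le_exp5] the coordinate term is at most [120 D / ((theta / 2)^5 r)]; this threshold
     on [r] makes it at most [c]. *)
  have rB : 120 * D / ((theta / 2) ^+ 5 * c) <= root4 N.
    by near: N; exact: root4_ge.
  have := @root4_exp R N.
  move: (root4 N) r1 rB => r r1 rB rN.
  have r0 : 0 < r by exact: lt_le_trans r1.
  have N0 : (0 < N)%N by rewrite -(@ltr_nat R) -rN exprn_gt0.
  have n0 : 0 < N%:R :> R by rewrite ltr0n.
  have small : N%:R * (expR (- (theta / 2 * r)) * D) <= c.
    apply: (@le_trans _ _ (N%:R * (120 / (theta / 2 * r) ^+ 5 * D))).
      rewrite ler_pM2l// ler_pM2r//; apply: expRN_le_exp5.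
      by rewrite mulr_gt0// divr_gt0.
    rewrite -rN.
    have -> : r ^+ 4 * (120 / (theta / 2 * r) ^+ 5 * D) =
       120 * D / (theta / 2) ^+ 5 / r by field; rewrite !gt_eqF.
    have x0 : 0 < (theta / 2) ^+ 5 by rewrite exprn_gt0// divr_gt0.
    move: rB; rewrite !ler_pdivrMr ?mulr_gt0 ?subr_gt0//.
    by move/le_trans; apply; rewrite le_eqVlt; apply/orP; left; apply/eqP; ring.
  have mass : ((c * A ^+ N)%:E <= \int[gaussn R N]_z
     (\1_(bulk beta r N) z * expR (lambda / 2 * sqnorm N z))%:E)%E.
    have := @bulk_mass R beta lambda theta r N t0 lt1.
    rewrite -/A -/D -/q; rewrite -leeBlDr// -EFinB; apply: le_trans.
    rewrite lee_fin -[X in _ <= X - _]mulr1 -mulrBr mulrC ler_pM2l ?exprn_gt0//.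
    have qN : q ^+ N <= q by rewrite -[leRHS]expr1 ler_wiXn2l// ltW.
    by move: small qN; rewrite /c; lra.
  have s0 : 0 < r ^- 3 by rewrite invr_gt0 exprn_gt0.
  have s1 : r ^- 3 <= 1 by rewrite invf_le1 ?exprn_gt0// exprn_ege1.
  have := @ElogZ_bounds R (\1_(bulk beta r N)) beta lambda N r c (r ^- 3)
   _ _ _ l1 b0 bl N0 (ltW r0) _ _ c0 c1 s0 s1 mass.
  case/(_ _ _ _ _ _)/andP.
  - by apply: measurable_indic; exact: measurable_bulk.
  - by move=> z; rewrite indicE.
  - by move=> z; rewrite indicE; case: (_ \in _).
  - by move=> z /indic_bulk_neq0[].
  - by move=> z /indic_bulk_neq0[].
  rewrite -/A -/L => lo hi; apply/andP; split.
    apply: (@le_trans _ _ ((N%:R^-1)%:E * (N%:R * ln A + ln c - (r ^- 3)^-1 *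
        (L + beta ^+ 2 / 2 * N%:R * r ^- 3 ^+ 2 * r ^+ 2))%:E)%E); last first.
      by apply: lee_wpmul2l => //; rewrite lee_fin invr_ge0.
    rewrite -EFinM lee_fin -rN.
    (* With [N = r^4], [T = r] and [s = r^(-3)] the concentration term [N s^2 T^2] equals 1, so
       after division by [N] the error is of order [1 / r]. *)
    have -> : (r ^+ 4)^-1 * (r ^+ 4 * ln A + ln c - (r ^- 3)^-1 *
        (L + beta ^+ 2 / 2 * r ^+ 4 * r ^- 3 ^+ 2 * r ^+ 2)) =
      ln A + ln c * (r ^- 3 * r^-1) - (L + beta ^+ 2 / 2) * r^-1.
      by field; rewrite gt_eqF.
    rewrite -[leRHS]addrA lerD2l /C.
    have lnc : ln c <= 0 by exact: ln_le0.
    have rV0 : 0 < r^-1 by rewrite invr_gt0.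
    have h1 : ln c * r^-1 <= ln c * (r ^- 3 * r^-1).
      by rewrite ler_wnM2l// -[leRHS]mul1r ler_pM2r.
    have h2 : (L + beta ^+ 2 / 2) * r^-1 <= (`|L| + beta ^+ 2 / 2) * r^-1.
      by rewrite ler_pM2r// lerD2r ler_norm.
    by move: h1 h2; rewrite mulrBl; lra.
  apply: (@le_trans _ _ ((N%:R^-1)%:E * (N%:R * ln A)%:E)%E).
    by apply: lee_wpmul2l => //; rewrite lee_fin invr_ge0.
  by rewrite -EFinM mulKf// gt_eqF.
rewrite -lnA; apply: (squeeze_cvge key); last exact: cvg_cst.
apply: cvg_EFin; first by near=> N.
rewrite -[X in _ --> X]subr0 -(mulr0 C).
apply: cvgB; first exact: cvg_cst.
by apply: cvgMr; exact: cvg_root4V.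
Unshelve. all: by end_near. Qed.
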